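(* Let $\mathcal G$ be a finite groupoid, $\mathcal H,\mathcal K$ a match pair of subgroupoids of $\mathcal G$, and let $(C(\mathcal K)\rtimes_{\delta^{\mathcal H}}C(\mathcal H),\Gamma^\delta,\kappa^\delta,\epsilon^\delta)$ be the weak Hopf $C^*$-algebra associated with the multiplicative partial isometry $I_{\mathcal H,\mathcal K}$. 1) For all $(k,h),(k',h')\in\mathcal K\,{}_s\!\times_r\mathcal H$: $$\chi_{(k,h)}\star_\delta\chi_{(k',h')}=\begin{cases}\chi_{(k,h)\,\square\downarrow(k',h')}&\text{if }k'=k\triangleleft h,\\0&\text{otherwise,}\end{cases}\qquad \chi_{(k,h)}^{\#}=\chi_{(k\triangleleft h,\,h^{-1})}.$$ The identification of $\mathcal K\,{}_s\!\times_r\mathcal H$ with the double groupoid $\mathcal T$ (sending $(k,h)$ to the box with top edge $k$ and right edge $h$) leads to a $C^*$-isomorphism between $C(\mathcal K)\rtimes_{\delta^{\mathcal H}}C(\mathcal H)$ and $\mathbb C\mathcal T$. 2) For every $(k,h)\in\mathcal K\,{}_s\!\times_r\mathcal H$: $$\Gamma^\delta(R^\delta(\chi_{(k,h)}))=\sum_{(k_1,h_1)\overset{\rightarrow}{\square}(k_2,h_2)=(k,h)}R^\delta(\chi_{(k_1,h_1)})\otimes R^\delta(\chi_{(k_2,h_2)}),$$ $$\kappa^\delta(R^\delta(\chi_{(k,h)}))=R^\delta\big(\chi_{((k\triangleleft h)^{-1},(k\triangleright h)^{-1})}\big),\qquad \epsilon^\delta(R^\delta(\chi_{(k,h)}))=\begin{cases}1&\text{if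 }k=r(h),\\0&\text{otherwise.}\end{cases}$$ $R^\delta$ is an isomorphism of $C^*$-quantum groupoids (weak Hopf $C^*$-algebras) between $\mathbb C\mathcal T$ and $(C(\mathcal K)\rtimes_{\delta^{\mathcal H}}C(\mathcal H),\Gamma^\delta,\kappa^\delta,\epsilon^\delta)$.
   Context: Groupoid conventions: $\mathcal G^0$ units, $s$ source, $r$ range, $xy$ defined iff $s(x)=r(y)$. Subgroupoids $\mathcal H,\mathcal K$ form a match pair if $\mathcal G=\{hk:h\in\mathcal H,k\in\mathcal K,s(h)=r(k)\}$ and $\mathcal H\cap\mathcal K\subset\mathcal G^0$. Each $g\in\mathcal G$ is uniquely $g=p_1(g)p_2(g)$ with $p_1(g)\in\mathcal H$, $p_2(g)\in\mathcal K$; $m=s\circ p_1=r\circ p_2$. For $k\in\mathcal K$, $h\in\mathcal H$ with $s(k)=r(h)$ write uniquely $kh=(k\triangleright h)(k\triangleleft h)$ with $k\triangleright h\in\mathcal H$, $k\triangleleft h\in\mathcal K$. $\chi_p$ is the characteristic function of $\{p\}$. Crossed product: $\mathcal K\,{}_s\!\times_r\mathcal H=\{(k,h)\in\mathcal K\times\mathcal H:s(k)=r(h)\}$. Functions on it form a $*$-algebra with $F\star_\delta F'(k,h)=\sum_{h'\in\mathcal H,\,r(h')=r(h)}F(k,h')F'(k\triangleleft h',h'^{-1}h)$, $F^{\#}(k,h)=\overline{F(k\triangleleft h,h^{-1})}$, represented on $l^2(\mathcal K\,{}_s\!\times_r\mathcal H)$ by $R^\delta(F)\xi(k,h)=\sum_{h'\in\mathcal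 H,\,r(h')=s(h)}F(k\triangleleft h,h')\xi(k,hh')$; $C(\mathcal K)\rtimes_{\delta^{\mathcal H}}C(\mathcal H)$ is the image of $R^\delta$. Quantum groupoid structure: let $I=I_{\mathcal H,\mathcal K}$ on $l^2(\mathcal G\times\mathcal G)$, $I(f)(x,y)=f(xp_1(p_2(x)^{-1}y),p_2(x)^{-1}y)$ if $m(x)=r(y)$ and $0$ otherwise. Identify $\mathcal K\,{}_s\!\times_r\mathcal H$ with $\mathcal G$ by $(k,h)\mapsto kh$; then $R^\delta(\chi_{(k,h)})$ becomes the operator $\xi\mapsto\big(g\mapsto \chi_{\{p_2(g)=k\}}\,\xi(gh)\big)$ on $l^2(\mathcal G)$, and $C(\mathcal K)\rtimes_{\delta^{\mathcal H}}C(\mathcal H)$ becomes $\hat S=\{(i\otimes\omega)(I):\omega\text{ a linear form on }\mathcal L(l^2(\mathcal G))\}$. The structure is $\Gamma^\delta(x)=I^*(1\otimes x)I$, $\kappa^\delta((i\otimes\omega)(I))=(i\otimes\omega)(I^* )$, $\epsilon^\delta((i\otimes\omega)(I))=\omega(1)$. (A weak Hopf $C^*$-algebra, or $C^*$-quantum groupoid, is a finite-dimensional $C^*$-algebra with coproduct, antipode and counit satisfying the B\''ohm–Nill–Szlach\'anyi axioms; an isomorphism is a $*$-algebra isomorphism preserving coproduct, antipode and counit.) Horizontal and vertical products on $\mathcal K\,{}_s\!\times_r\mathcal H$: $(k,h)\overset{\rightarrow}{\square}(k',h')=(kk',h')$, defined when $h=k'\triangleright h'$; $(k,h)\,\square\downarrow(k',h')=(k,hh')$,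 defined when $k'=k\triangleleft h$. The double groupoid $\mathcal T$ of the match pair consists of boxes with top $k$, right $h$, left $k\triangleright h$, bottom $k\triangleleft h$, $(k,h)\in\mathcal K\,{}_s\!\times_r\mathcal H$, with these horizontal and vertical compositions. The weak Hopf $C^*$-algebra $\mathbb C\mathcal T$ (Andruskiewitsch–Natale) has basis $\mathcal T$, product the vertical composition ($0$ if not composable), involution the antilinear extension of the vertical inverse, coproduct $\Delta(B)=\sum B_1\otimes B_2$ over all $B_1\overset{\rightarrow}{\square}B_2=B$, antipode sending $(k,h)$ to $((k\triangleleft h)^{-1},(k\triangleright h)^{-1})$, and counit $1$ on boxes $(k,h)$ with $k\in\mathcal G^0$ and $0$ on the others. $R^\delta$ is viewed on $\mathbb C\mathcal T$ through $(k,h)\mapsto R^\delta(\chi_{(k,h)})$. *)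

(* Defs.v *)
From HB Require Import structures.
From mathcomp Require Import all_boot all_order all_algebra.
From mathcomp Require Import reals complex.

Set Implicit Arguments.
Unset Strict Implicit.
Unset Printing Implicit Defensive.
Import GRing.Theory Num.Theory.
Local Open Scope ring_scope.

(* Finite groupoids.  Units are identified with their identity arrows; gmul is
   total, and its values are meaningful only when gsrc x = grng y. *)
Record finGroupoid := FinGroupoid {
  arrow :> finType;
  gsrc : arrow -> arrow;
  grng : arrow -> arrow;
  gmul : arrow -> arrow -> arrow;
  ginv : arrow -> arrow;
  gsrc_src : forall x, gsrc (gsrc x) = gsrc x;
  grng_src : forall x, grng (gsrc x) = gsrc x;
  gsrc_rng : forall x, gsrc (grng x) = grng x;
  grng_rng : forall x, grng (grng x) = grng x;
  gsrc_mul : forall x y, gsrc x = grng y -> gsrc (gmul x y) = gsrc y;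
  grng_mul : forall x y, gsrc x = grng y -> grng (gmul x y) = grng x;
  gmulA : forall x y z, gsrc x = grng y -> gsrc y = grng z ->
    gmul x (gmul y z) = gmul (gmul x y) z;
  gmul_src : forall x, gmul x (gsrc x) = x;
  gmul_rng : forall x, gmul (grng x) x = x;
  gsrc_inv : forall x, gsrc (ginv x) = grng x;
  grng_inv : forall x, grng (ginv x) = gsrc x;
  gmulxV : forall x, gmul x (ginv x) = grng x;
  gmulVx : forall x, gmul (ginv x) x = gsrc x
}.

Declare Scope groupoid_scope.
Delimit Scope groupoid_scope with gpd.
Notation "x ** y" := (gmul x y) (at level 40, left associativity)
  : groupoid_scope.
Local Open Scope groupoid_scope.

Section MatchPair.
Variable G : finGroupoid.
Implicit Types (H K : {set G}) (g h k : G).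

Definition gunit g := gsrc g == g.

Definition subgroupoid H :=
  (forall x y, x \in H -> y \in H -> gsrc x = grng y -> x ** y \in H)
  /\ (forall x, x \in H -> ginv x \in H).

Definition match_pair H K :=
  [/\ subgroupoid H, subgroupoid K,
      forall g, exists h k,
        [/\ h \in H, k \in K, gsrc h = grng k & g = h ** k]
    & forall g, g \in H -> g \in K -> gunit g].

(* For a match pair the decomposition picked here exists and is unique; the
   default value (g, g) is then never used. *)
Definition mp_dec H K g : G * G :=
  odflt (g, g) [pick q : G * G |
    [&& q.1 \in H, q.2 \in K, gsrc q.1 == grng q.2 & q.1 ** q.2 == g]].
Definition p1 H K g : G := (mp_dec H K g).1.
Definition p2 H K g : G := (mp_dec H K g).2.
Definition mid H K g : G := gsrc (p1 H K g).
Definition lact H K k h : G := p1 H K (k ** h).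
Definition ract H K k h : G := p2 H K (k ** h).

Definition crossed_pair H K (q : G * G) : bool :=
  [&& q.1 \in K, q.2 \in H & gsrc q.1 == grng q.2].

(* The pair (k, h), with gsrc k = grng h, is also the box of the double
   groupoid with top edge k and right edge h. *)
Definition box H K := {q : G * G | crossed_pair H K q}.

End MatchPair.

Section Boxes.
Variables (G : finGroupoid) (H K : {set G}).
Implicit Types b : box H K.

Definition top b : G := (val b).1.
Definition right b : G := (val b).2.
Definition left b : G := lact H K (top b) (right b).
Definition bottom b : G := ract H K (top b) (right b).

(* The compositions and inverses are given by their (top, right) pairs of
   edges. *)
Definition hcomposable b b' := right b == left b'.
Definition hcomp b b' : G * G := (top b ** top b', right b').
Definition vcomposable b b' := bottom b == top b'.
Definition vcomp b b' : G * G := (top b, right b ** right b').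
Definition vinv b : G * G := (bottom b, ginv (right b)).
Definition hvinv b : G * G := (ginv (bottom b), ginv (left b)).

End Boxes.

Notation l2 C X := {ffun X -> C^o}.
Notation op C X := 'End(l2 C X).

Section Operators.
Variable C : numClosedFieldType.

Definition dirac (X : finType) (x : X) : l2 C X := [ffun y => (y == x)%:R].

Definition op_of (X : finType) (M : X -> X -> C) : op C X :=
  linfun (fun xi : l2 C X => [ffun x => \sum_y M x y * xi y] : l2 C X).
Definition entry (X : finType) (T : op C X) (x y : X) : C := T (dirac y) x.

Definition opadj (X : finType) (T : op C X) : op C X :=
  op_of (fun x y => (entry T y x)^*).

(* l2 X (x) l2 Y is identified with l2 (X * Y). *)
Definition optens (X Y : finType) (S : op C X) (T : op C Y) : op C (X * Y)%type :=
  op_of (fun x y => entry S x.1 y.1 * entry T x.2 y.2).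

(* (i (x) omega)(T) *)
Definition slice (X Y : finType) (T : op C (X * Y)%type)
    (omega : 'Hom(op C Y, C^o)) : op C X :=
  op_of (fun x x' => omega (op_of (fun y y' => entry T (x, y) (x', y')))).

End Operators.

Section Tensor.
Variable C : fieldType.

(* Algebraic tensor product of two finite-dimensional spaces: coordinates on
   the basis formed by the tensors of basis vectors. *)
Definition tensor (A B : vectType C) : vectType C :=
  'M[C]_(\dim {:A}, \dim {:B}).

Definition tens (A B : vectType C) (a : A) (b : B) : tensor A B :=
  \matrix_(i, j) (coord (vbasis {:A}) i a * coord (vbasis {:B}) j b).

(* The linear map induced by the bilinear map f. *)
Definition tlift (A B : vectType C) (V : lmodType C) (f : A -> B -> V)
    (t : tensor A B) : V :=
  \sum_i \sum_j (t : 'M_(_, _)) i j *: f (vbasis {:A})`_i (vbasis {:B})`_j.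

Definition tmul (A B : vectType C) (mA : A -> A -> A) (mB : B -> B -> B)
    (s t : tensor A B) : tensor A B :=
  tlift (fun a b => tlift (fun c d => tens (mA a c) (mB b d)) t) s.

Definition tmap (A A' B B' : vectType C) (f : A -> A') (g : B -> B') :
    tensor A B -> tensor A' B' :=
  tlift (fun a b => tens (f a) (g b)).

(* The canonical identification of A (x) (B (x) D) with (A (x) B) (x) D. *)
Definition tassoc (A B D : vectType C) :
    tensor A (tensor B D) -> tensor (tensor A B) D :=
  tlift (fun a u => tlift (fun b d => tens (tens a b) d) u).

Definition tensv (A : vectType C) (V : {vspace A}) : {vspace tensor A A} :=
  <<[seq tens a b | a <- vbasis V, b <- vbasis V]>>%VS.

End Tensor.

Section WeakHopf.
Variable C : numClosedFieldType.

(* A unital *-algebra given as a subspace of an ambient unital *-algebra, so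
   that abstract algebras (the full subspace) and algebras of operators are
   treated alike. *)
Record starAlg := StarAlg {
  sa_amb : vectType C;
  sa_sub : {vspace sa_amb};
  sa_mul : sa_amb -> sa_amb -> sa_amb;
  sa_one : sa_amb;
  sa_star : sa_amb -> sa_amb
}.

Record starAlgP (A : starAlg) : Prop := {
  sa_mulDl : forall a b x y : sa_amb A, forall c : C,
    sa_mul (c *: a + b) x = c *: sa_mul a x + sa_mul b x;
  sa_mulDr : forall a x y : sa_amb A, forall c : C,
    sa_mul a (c *: x + y) = c *: sa_mul a x + sa_mul a y;
  sa_mulA : associative (@sa_mul A);
  sa_mul1l : left_id (sa_one A) (@sa_mul A);
  sa_mul1r : right_id (sa_one A) (@sa_mul A);
  sa_starD : forall (x y : sa_amb A) (c : C),
    sa_star (c *: x + y) = c^* *: sa_star x + sa_star y;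
  sa_starK : involutive (@sa_star A);
  sa_starM : forall x y : sa_amb A,
    sa_star (sa_mul x y) = sa_mul (sa_star y) (sa_star x);
  sa_one_sub : sa_one A \in sa_sub A;
  sa_mul_sub : forall x y, x \in sa_sub A -> y \in sa_sub A ->
    sa_mul x y \in sa_sub A;
  sa_star_sub : forall x, x \in sa_sub A -> sa_star x \in sa_sub A
}.

(* Completeness of the norm is automatic in finite dimension. *)
Record cstar_norm (A : starAlg) (N : sa_amb A -> C) : Prop := {
  cn_ge0 : forall x, x \in sa_sub A -> 0 <= N x;
  cn_eq0 : forall x, x \in sa_sub A -> N x = 0 -> x = 0;
  cn_scale : forall (c : C) x, x \in sa_sub A -> N (c *: x) = `|c| * N x;
  cn_triangle : forall x y, x \in sa_sub A -> y \in sa_sub A ->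
    N (x + y) <= N x + N y;
  cn_mul : forall x y, x \in sa_sub A -> y \in sa_sub A ->
    N (sa_mul x y) <= N x * N y;
  cn_cstar : forall x, x \in sa_sub A -> N (sa_mul (sa_star x) x) = N x ^+ 2
}.

Definition cstar_algebra (A : starAlg) : Prop :=
  starAlgP A /\ exists N : sa_amb A -> C, cstar_norm N.

Record star_iso (A B : starAlg) (f : sa_amb A -> sa_amb B) : Prop := {
  si_linear : linear f;
  si_sub : forall x, x \in sa_sub A -> f x \in sa_sub B;
  si_inj : {in sa_sub A &, injective f};
  si_surj : forall y, y \in sa_sub B -> exists2 x, x \in sa_sub A & f x = y;
  si_mul : forall x y, x \in sa_sub A -> y \in sa_sub A ->
    f (sa_mul x y) = sa_mul (f x) (f y);
  si_one : f (sa_one A) = sa_one B;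
  si_star : forall x, x \in sa_sub A -> f (sa_star x) = sa_star (f x)
}.

Definition cstar_iso (A B : starAlg) (f : sa_amb A -> sa_amb B) : Prop :=
  [/\ cstar_algebra A, cstar_algebra B & star_iso f].

Record whAlg := WhAlg {
  wh_alg :> starAlg;
  wh_delta : sa_amb wh_alg -> tensor (sa_amb wh_alg) (sa_amb wh_alg);
  wh_S : sa_amb wh_alg -> sa_amb wh_alg;
  wh_eps : sa_amb wh_alg -> C
}.

(* The axioms of Bohm, Nill and Szlachanyi, Sweedler sums being expressed by
   tlift. *)
Record weak_hopf_cstar (A : whAlg) : Prop := {
  wh_cstar : cstar_algebra A;
  wh_delta_lin : linear (@wh_delta A);
  wh_S_lin : linear (@wh_S A);
  wh_eps_lin : scalar (@wh_eps A);
  wh_delta_sub : forall x, x \in sa_sub A -> wh_delta x \in tensv (sa_sub A);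
  wh_S_sub : forall x, x \in sa_sub A -> wh_S x \in sa_sub A;
  wh_coassoc : forall x, x \in sa_sub A ->
    tmap (@wh_delta A) id (wh_delta x)
    = tassoc (tmap id (@wh_delta A) (wh_delta x));
  wh_counitl : forall x, x \in sa_sub A ->
    tlift (fun a b => wh_eps a *: b) (wh_delta x) = x;
  wh_counitr : forall x, x \in sa_sub A ->
    tlift (fun a b => wh_eps b *: a) (wh_delta x) = x;
  wh_delta_mul : forall x y, x \in sa_sub A -> y \in sa_sub A ->
    wh_delta (sa_mul x y)
    = tmul (@sa_mul A) (@sa_mul A) (wh_delta x) (wh_delta y);
  wh_delta_star : forall x, x \in sa_sub A ->
    wh_delta (sa_star x)
    = tmap (@sa_star A) (@sa_star A)
        (map_mx (fun c : C => c^*) (wh_delta x : 'M_(_, _)));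
  wh_delta_one1 :
    tmap (@wh_delta A) id (wh_delta (sa_one A))
    = tmul (tmul (@sa_mul A) (@sa_mul A)) (@sa_mul A)
        (tens (wh_delta (sa_one A)) (sa_one A))
        (tassoc (tens (sa_one A) (wh_delta (sa_one A))));
  wh_delta_one2 :
    tmap (@wh_delta A) id (wh_delta (sa_one A))
    = tmul (tmul (@sa_mul A) (@sa_mul A)) (@sa_mul A)
        (tassoc (tens (sa_one A) (wh_delta (sa_one A))))
        (tens (wh_delta (sa_one A)) (sa_one A));
  wh_eps_mul1 : forall x y z,
    x \in sa_sub A -> y \in sa_sub A -> z \in sa_sub A ->
    wh_eps (sa_mul (sa_mul x y) z)
    = tlift (fun a b => wh_eps (sa_mul x a) * wh_eps (sa_mul b z) : C^o)
        (wh_delta y);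
  wh_eps_mul2 : forall x y z,
    x \in sa_sub A -> y \in sa_sub A -> z \in sa_sub A ->
    wh_eps (sa_mul (sa_mul x y) z)
    = tlift (fun a b => wh_eps (sa_mul x b) * wh_eps (sa_mul a z) : C^o)
        (wh_delta y);
  wh_antipode_t : forall x, x \in sa_sub A ->
    tlift (fun a b => sa_mul a (wh_S b)) (wh_delta x)
    = tlift (fun a b => wh_eps (sa_mul a x) *: b) (wh_delta (sa_one A));
  wh_antipode_s : forall x, x \in sa_sub A ->
    tlift (fun a b => sa_mul (wh_S a) b) (wh_delta x)
    = tlift (fun a b => wh_eps (sa_mul x b) *: a) (wh_delta (sa_one A));
  wh_antipode : forall x, x \in sa_sub A ->
    tlift (fun u c => tlift (fun a b => sa_mul (sa_mul (wh_S a) b) (wh_S c)) u)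
      (tmap (@wh_delta A) id (wh_delta x))
    = wh_S x
}.

Definition weak_hopf_cstar_iso (A B : whAlg) (f : sa_amb A -> sa_amb B) :=
  [/\ weak_hopf_cstar A, weak_hopf_cstar B, star_iso f
    & forall x, x \in sa_sub A ->
      [/\ wh_delta (f x) = tmap f f (wh_delta x),
          wh_S (f x) = f (wh_S x) & wh_eps (f x) = wh_eps x]].

End WeakHopf.

Section CrossedProduct.
Variables (C : numClosedFieldType) (G : finGroupoid) (H K : {set G}).
Local Notation box := (box H K).
Local Notation p1 := (p1 H K).
Local Notation p2 := (p2 H K).
Local Notation m := (mid H K).
Implicit Types (F : l2 C box) (b : box) (q : G * G).

(* chi q is meant for pairs q satisfying crossed_pair (see vcomp_pair,
   hcomp_pair, vinv_pair and hvinv_pair below) and is 0 for other pairs; ev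
   extends functions on the boxes by 0. *)
Definition chi q : l2 C box := [ffun b => (val b == q)%:R].
Definition ev F q : C := if insub q is Some b then F b else 0.

Definition conv F F' : l2 C box := [ffun b =>
  \sum_(h in H | grng h == grng (right b))
    ev F (top b, h) * ev F' (ract H K (top b) h, ginv h ** right b)].
Definition sharp F : l2 C box := [ffun b => (ev F (vinv b))^*].

Definition Rdelta F : op C box :=
  linfun (fun xi : l2 C box => [ffun b =>
    \sum_(h in H | grng h == gsrc (right b))
      ev F (bottom b, h) * ev xi (top b, right b ** h)] : l2 C box).

(* Rdelta transported to l2 G along the bijection (k, h) |-> k ** h. *)
Definition pull : 'Hom(l2 C G, l2 C box) :=
  linfun (fun xi : l2 C G => [ffun b => xi (top b ** right b)] : l2 C box).
Definition RdeltaG F : op C G := (pull^-1 \o Rdelta F \o pull)%VF.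

(* The same crossed product, acting on l2 box and on l2 G. *)
Definition crossed_box : {vspace op C box} := limg (linfun Rdelta).
Definition crossed : {vspace op C G} := limg (linfun RdeltaG).

Definition Iop : op C (G * G)%type :=
  linfun (fun f : l2 C (G * G)%type => [ffun q : G * G =>
    let: (x, y) := q in let z := ginv (p2 x) ** y in
    if m x == grng y then f (x ** p1 z, z) else 0] : l2 C (G * G)%type).

Definition sliceI : 'Hom('Hom(op C G, C^o), op C G) := linfun (slice Iop).
Definition Shat : {vspace op C G} := limg sliceI.

Definition Gamma (T : op C G) : op C (G * G)%type :=
  (opadj Iop \o (optens \1 T \o Iop))%VF.

(* sliceI^-1 chooses a linear form representing a given element of Shat; see
   crossed_Shat, kappa_slice and eps_slice below for the independence of the
   choice. *)
Definition kappa (T : op C G) : op C G :=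
  slice (opadj Iop) ((sliceI^-1)%VF T).
Definition eps (T : op C G) : C := ((sliceI^-1)%VF T) \1%VF.

(* The identification of L(l2 G) (x) L(l2 G) with L(l2 (G * G)); it is
   bijective by tens_op_bij below. *)
Definition tens_op : 'Hom(tensor (op C G) (op C G), op C (G * G)%type) :=
  linfun (tlift (fun S T : op C G => optens S T)).

Definition crossed_box_alg : starAlg C :=
  @StarAlg C (op C box) crossed_box (fun S T => (S \o T)%VF) \1%VF
    (@opadj C box).

Definition crossed_alg : starAlg C :=
  @StarAlg C (op C G) crossed (fun S T => (S \o T)%VF) \1%VF (@opadj C G).

Definition crossed_wh : whAlg C :=
  @WhAlg C crossed_alg (fun T => (tens_op^-1)%VF (Gamma T)) kappa eps.

(* The algebra spanned by the boxes of the double groupoid, chi (val b) being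
   the basis vector b. *)
Definition dg_mul F F' : l2 C box :=
  \sum_b \sum_(b' | vcomposable b b') (F b * F' b') *: chi (vcomp b b').
Definition dg_one : l2 C box := [ffun b => (gunit (right b))%:R].
Definition dg_star F : l2 C box := \sum_b (F b)^* *: chi (vinv b).
Definition dg_delta F : tensor (l2 C box) (l2 C box) :=
  \sum_b F b *: \sum_(bb : box * box |
      hcomposable bb.1 bb.2 && (hcomp bb.1 bb.2 == val b))
    tens (chi (val bb.1)) (chi (val bb.2)).
Definition dg_S F : l2 C box := \sum_b F b *: chi (hvinv b).
Definition dg_eps F : C := \sum_(b | gunit (top b)) F b.

Definition dg_alg : starAlg C :=
  @StarAlg C (l2 C box) fullv dg_mul dg_one dg_star.
Definition dg_wh : whAlg C := @WhAlg C dg_alg dg_delta dg_S dg_eps.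

End CrossedProduct.

(* Independence of the choices made above. *)
Section WellDefined.
Variable C : numClosedFieldType.

Lemma linfun_lin (U V : vectType C) (f : U -> V) :
  linear f -> linfun f =1 f.
Proof.
move=> lf x.
pose fL : {linear U -> V} := HB.pack f (GRing.isLinear.Build C U V _ f lf).
by rewrite -[RHS]/(fL x) -(lfunE fL).
Qed.

Lemma op_ofE (X : finType) (M : X -> X -> C) (xi : l2 C X) x :
  op_of M xi x = \sum_y M x y * xi y.
Proof.
rewrite /op_of linfun_lin ?ffunE // => c u v; apply/ffunP=> y.
rewrite !ffunE scaler_sumr -big_split /=; apply: eq_bigr => z _.
by rewrite !ffunE /= mulrDr mulrCA.
Qed.

Lemma entry_op_of (X : finType) (M : X -> X -> C) x y :
  entry (op_of M) x y = M x y.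
Proof.
rewrite /entry op_ofE (bigD1 y) //= ffunE eqxx mulr1 big1 ?addr0 // => z zy.
by rewrite ffunE (negPf zy) mulr0.
Qed.

Lemma entry_inj (X : finType) (S T : op C X) :
  (forall x y, entry S x y = entry T x y) -> S = T.
Proof.
move=> eST; apply/lfunP => xi; apply/ffunP=> x.
have -> : xi = \sum_y xi y *: dirac C y.
  apply/ffunP=> z; rewrite sum_ffunE (bigD1 z) //= !ffunE eqxx big1.
    by rewrite addr0 /GRing.scale /= mulr1.
  by move=> y yz; rewrite !ffunE eq_sym (negPf yz) /GRing.scale /= mulr0.
rewrite !linear_sum !sum_ffunE; apply: eq_bigr => y _.
by rewrite !linearZ !ffunE; congr (_ *: _); apply: eST.
Qed.

Lemma entry_lin (X : finType) (x y : X) : scalar (fun T : op C X => entry T x y).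
Proof. by move=> c S T; rewrite /entry add_lfunE scale_lfunE !ffunE. Qed.

Lemma entryD (X : finType) (S T : op C X) x y :
  entry (S + T) x y = entry S x y + entry T x y.
Proof. by have := entry_lin x y 1 S T; rewrite scale1r mul1r. Qed.

Lemma entry0 (X : finType) (x y : X) : entry (0 : op C X) x y = 0.
Proof. by rewrite /entry lfunE /= ffunE. Qed.

Lemma entryZ (X : finType) c (T : op C X) x y :
  entry (c *: T) x y = c * entry T x y.
Proof. by have := entry_lin x y c T 0; rewrite addr0 entry0 addr0. Qed.

Lemma entry_sum (X I : finType) (P : pred I) (T : I -> op C X) x y :
  entry (\sum_(i | P i) T i) x y = \sum_(i | P i) entry (T i) x y.
Proof. exact: (big_morph _ (fun S T => entryD S T x y) (entry0 x y)). Qed.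

Lemma slice_lin (X Y : finType) (T : op C (X * Y)%type) : linear (slice T).
Proof.
move=> c u v; apply: entry_inj => x y.
by rewrite entryD entryZ !entry_op_of add_lfunE scale_lfunE.
Qed.

Section Groupoid.
Variable G : finGroupoid.
Implicit Types g x y z : G.

Lemma gmulKV x y : gsrc x = grng y -> ginv x ** (x ** y) = y.
Proof. by move=> e; rewrite gmulA ?gsrc_inv // gmulVx e gmul_rng. Qed.

Lemma gmulVK x y : grng x = grng y -> x ** (ginv x ** y) = y.
Proof. by move=> e; rewrite gmulA ?grng_inv ?gsrc_inv // gmulxV e gmul_rng. Qed.

Lemma gunit_rng x : gunit x -> grng x = x.
Proof. by move/eqP=> <-; rewrite grng_src. Qed.

Lemma gunit_mul x y : gunit x -> gsrc x = grng y -> x ** y = y.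
Proof. by move=> /eqP ux e; rewrite -[x in LHS]ux e gmul_rng. Qed.

Lemma mul_gunit x y : gunit y -> gsrc x = grng y -> x ** y = x.
Proof. by move=> uy e; rewrite -(gunit_rng uy) -e gmul_src. Qed.

Lemma gmulI x y z : gsrc x = grng y -> gsrc x = grng z ->
  x ** y = x ** z -> y = z.
Proof. by move=> ey ez e; rewrite -(gmulKV ey) e gmulKV. Qed.

Lemma ginvK x : ginv (ginv x) = x.
Proof.
apply: (@gmulI (ginv x)); rewrite ?grng_inv ?gsrc_inv //.
by rewrite gmulxV gmulVx grng_inv.
Qed.

Lemma ginv_uniq x y : gsrc x = grng y -> gunit (x ** y) -> x = ginv y.
Proof.
move=> e u; rewrite -[x]gmul_src e -gmulxV gmulA ?grng_inv //.
by apply: gunit_mul => //; rewrite gsrc_mul // grng_inv.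
Qed.

Lemma ginv_mul x y : gsrc x = grng y -> ginv (x ** y) = ginv y ** ginv x.
Proof.
move=> e; apply: (@gmulI (x ** y)).
- by rewrite grng_inv.
- by rewrite grng_mul ?grng_inv ?gsrc_inv ?gsrc_mul.
rewrite gmulxV grng_mul // -gmulA ?grng_mul ?grng_inv ?gsrc_inv //.
by rewrite gmulVK ?grng_inv ?gmulxV.
Qed.

End Groupoid.

Section MatchPairTheory.
Variables (G : finGroupoid) (H K : {set G}).
Hypothesis mHK : match_pair H K.
Local Notation box := (box H K).
Local Notation p1 := (p1 H K).
Local Notation p2 := (p2 H K).

Lemma p_dec g :
  [/\ p1 g \in H, p2 g \in K, gsrc (p1 g) = grng (p2 g) & p1 g ** p2 g = g].
Proof.
rewrite /p1 /p2 /mp_dec; case: pickP => [q /and4P[? ? /eqP ? /eqP ?]|no] //=.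
case: mHK => _ _ /(_ g)[h [k [hH kK e eg]]] _.
by have := no (h, k); rewrite /= hH kK e eqxx eg eqxx.
Qed.

Lemma p_uniq h k : h \in H -> k \in K -> gsrc h = grng k ->
  p1 (h ** k) = h /\ p2 (h ** k) = k.
Proof.
move=> hH kK e; have [h'H k'K e' eg] := p_dec (h ** k).
move: (p1 _) (p2 _) h'H k'K e' eg => h' k' h'H k'K e' eg.
case: mHK => [[HM HV] [KM KV] _ HKu].
have er : grng h' = grng h by rewrite -(grng_mul e) -eg grng_mul.
have es : gsrc k' = gsrc k by rewrite -(gsrc_mul e) -eg gsrc_mul.
have euv : ginv h' ** h = k' ** ginv k.
  have -> : h = (h' ** k') ** ginv k.
    by rewrite eg -gmulA ?grng_inv // gmulxV -e gmul_src.
  by rewrite -gmulA ?grng_inv // gmulKV ?grng_mul ?grng_inv.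
have uu : gunit (ginv h' ** h).
  apply: HKu; first by apply: HM => //; [exact: HV | rewrite gsrc_inv].
  by rewrite euv; apply: KM => //; [exact: KV | rewrite grng_inv].
have eh : h' = h.
  rewrite -[RHS](gmulVK er) mul_gunit //.
  by rewrite grng_mul ?grng_inv ?gsrc_inv.
split=> //; apply: (@gmulI _ h) => //; first by rewrite -eh.
by rewrite -eg eh.
Qed.

Lemma p1M h k : h \in H -> k \in K -> gsrc h = grng k -> p1 (h ** k) = h.
Proof. by move=> hH kK e; case: (p_uniq hH kK e). Qed.

Lemma p2M h k : h \in H -> k \in K -> gsrc h = grng k -> p2 (h ** k) = k.
Proof. by move=> hH kK e; case: (p_uniq hH kK e). Qed.

Lemma unit_in u : gunit u -> (u \in H) && (u \in K).
Proof.
move=> uu; have [hH kK e eu] := p_dec u.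
case: mHK => [[_ HV] _ _ HKu].
have hk : p1 u = ginv (p2 u) by apply: ginv_uniq => //; rewrite eu.
have kh : p2 u \in H by rewrite -[p2 u]ginvK -hk HV.
have ku := HKu _ kh kK.
have eh : p1 u = u by rewrite -[RHS]eu mul_gunit.
have ek : p2 u = u.
  rewrite -[RHS]eu gunit_mul // hk -[p2 u]gunit_rng //.
  have -> : ginv (grng (p2 u)) = grng (p2 u).
    apply/esym/ginv_uniq; rewrite ?gsrc_rng ?grng_rng //.
    by rewrite gunit_mul /gunit ?gsrc_rng ?grng_rng ?eqxx.
  by rewrite /gunit gsrc_rng.
by rewrite -[X in (X \in H)]eh hH -[X in (X \in K)]ek.
Qed.

Lemma src_in x : (gsrc x \in H) && (gsrc x \in K).
Proof. by apply: unit_in; rewrite /gunit gsrc_src. Qed.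

Lemma p1H h : h \in H -> p1 h = h.
Proof.
move=> hH; rewrite -[h in LHS]gmul_src; apply: p1M => //.
  by case/andP: (src_in h).
by rewrite grng_src.
Qed.

Lemma p2K k : k \in K -> p2 k = k.
Proof.
move=> kK; have rK : (grng k \in H) by rewrite -gsrc_inv; case/andP: (src_in (ginv k)).
by rewrite -[k in LHS]gmul_rng; apply: p2M; rewrite ?gsrc_rng.
Qed.

Lemma boxP (b : box) : [/\ top b \in K, right b \in H & gsrc (top b) = grng (right b)].
Proof. by have /and3P[? ? /eqP] := valP b. Qed.

Lemma box_inj (b b' : box) : top b = top b' -> right b = right b' -> b = b'.
Proof.
case: b b' => [[k h] i] [[k' h'] i']; rewrite /top /right /= => e1 e2.
by apply: val_inj => /=; rewrite e1 e2.
Qed.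

Lemma mul_box_dec g : { b : box | top b ** right b = g }.
Proof.
have [hH kK e eg] := p_dec (ginv g).
case: mHK => [[_ HV] [_ KV] _ _].
have ok : crossed_pair H K (ginv (p2 (ginv g)), ginv (p1 (ginv g))).
  by rewrite /crossed_pair /= HV // KV // gsrc_inv grng_inv e eqxx.
by exists (exist (crossed_pair H K) _ ok); rewrite /top /right /= -ginv_mul // eg ginvK.
Qed.

Lemma mul_box_inj (b b' : box) :
  top b ** right b = top b' ** right b' -> b = b'.
Proof.
have [kK hH e] := boxP b; have [kK' hH' e'] := boxP b' => E.
case: mHK => [[_ HV] [_ KV] _ _].
have E' : ginv (right b) ** ginv (top b) = ginv (right b') ** ginv (top b').
  by rewrite -!ginv_mul // E.
have e1 : gsrc (ginv (right b)) = grng (ginv (top b)) by rewrite gsrc_inv grng_inv.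
have e2 : gsrc (ginv (right b')) = grng (ginv (top b')) by rewrite gsrc_inv grng_inv.
apply: box_inj.
  have := p2M (HV _ hH) (KV _ kK) e1; rewrite E' p2M ?HV ?KV // => E2.
  by rewrite -[LHS]ginvK -E2 ginvK.
have := p1M (HV _ hH) (KV _ kK) e1; rewrite E' p1M ?HV ?KV // => E2.
by rewrite -[LHS]ginvK -E2 ginvK.
Qed.

Lemma p2_mul_box (b : box) : p2 (top b ** right b) = bottom b.
Proof. by []. Qed.

Lemma ev_box (F : l2 C box) (b : box) k h :
  k = top b -> h = right b -> ev F (k, h) = F b.
Proof.
move=> -> ->; rewrite /ev.
have -> : (top b, right b) = val b by rewrite /top /right; case: (val b).
by rewrite valK.
Qed.

Lemma ev_pair (F : l2 C box) k h : k \in K -> h \in H -> gsrc k = grng h ->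
  { b : box | [/\ top b = k, right b = h & ev F (k, h) = F b] }.
Proof.
move=> kK hH e.
have ok : crossed_pair H K (k, h) by rewrite /crossed_pair /= kK hH e eqxx.
by exists (exist (crossed_pair H K) _ ok); split=> //; apply: ev_box.
Qed.

Lemma ev_lin q : scalar (fun F : l2 C box => ev F q).
Proof.
move=> c F F'; rewrite /ev; case: insub => [b|]; last by rewrite mulr0 addr0.
by rewrite !ffunE.
Qed.

Lemma RdeltaE (F : l2 C box) (xi : l2 C box) (b : box) :
  Rdelta F xi b = \sum_(h in H | grng h == gsrc (right b))
    ev F (bottom b, h) * ev xi (top b, right b ** h).
Proof.
rewrite /Rdelta linfun_lin ?ffunE // => c u v; apply/ffunP=> d.
rewrite !ffunE scaler_sumr -big_split /=; apply: eq_bigr => h _.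
by rewrite ev_lin mulrDr mulrCA.
Qed.

Lemma pullE (xi : l2 C G) (b : box) : pull C H K xi b = xi (top b ** right b).
Proof.
rewrite /pull linfun_lin ?ffunE // => c u v; apply/ffunP=> d.
by rewrite !ffunE.
Qed.

Lemma pull_ker : lker (pull C H K) == 0%VS.
Proof.
apply/lker0P => xi eta e; apply/ffunP=> g; have [b <-] := mul_box_dec g.
by rewrite -!pullE e.
Qed.

Lemma pull_im : limg (pull C H K) = fullv.
Proof.
apply/vspaceP => F; rewrite memvf; apply/memv_imgP.
exists [ffun g => F (sval (mul_box_dec g))]; first by rewrite memvf.
apply/ffunP=> b; rewrite pullE ffunE; congr (F _).
by apply: mul_box_inj; case: mul_box_dec.
Qed.

Lemma RdeltaG_chi (b : box) (xi : l2 C G) g :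
  RdeltaG (chi C H K (val b)) xi g = (p2 g == top b)%:R * xi (g ** right b).
Proof.
have [d <-] := mul_box_dec g; rewrite -pullE /RdeltaG !comp_lfunE /=.
rewrite limg_lfunVK ?pull_im ?memvf // RdeltaE p2_mul_box.
have [kK hH e] := boxP d; have [kK' hH' e'] := boxP b.
have [p1H' p2K' ep epg] := p_dec (top d ** right d).
have sb : gsrc (bottom d) = gsrc (right d).
  by rewrite -(gsrc_mul e) -[in RHS]epg gsrc_mul.
have [eb|nb] := eqVneq (bottom d) (top b); last first.
  rewrite mul0r big1 // => h /andP[hIH /eqP eh].
  have [|b1 [t1 r1 ->]] := ev_pair (chi C H K (val b)) p2K' hIH.
    by rewrite p2_mul_box sb eh.
  rewrite ffunE; case: eqP => [/val_inj b1b|]; last by rewrite mul0r.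
  by rewrite -p2_mul_box -t1 b1b eqxx in nb.
have rb : grng (right b) == gsrc (right d) by rewrite -e' -eb sb.
rewrite (bigD1 (right b)) ?hH' ?rb //= big1 ?addr0; last first.
  move=> h /andP[/andP[hIH /eqP eh] nh].
  have [|b1 [t1 r1 ->]] := ev_pair (chi C H K (val b)) p2K' hIH.
    by rewrite p2_mul_box sb eh.
  rewrite ffunE; case: eqP => [/val_inj b1b|]; last by rewrite mul0r.
  by rewrite -r1 b1b eqxx in nh.
rewrite (@ev_box _ b) // ffunE eqxx.
have HM : right d ** right b \in H.
  by case: mHK => [[HM _] _ _ _]; apply: HM => //; rewrite (eqP rb).
have [|b1 [t1 r1 ->]] := ev_pair (pull C H K xi) kK HM.
  by rewrite grng_mul // (eqP rb).
by rewrite pullE t1 r1 gmulA // (eqP rb).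
Qed.

Lemma Rdelta_lin : linear (@Rdelta C G H K).
Proof.
move=> c F F'; apply/lfunP=> xi; apply/ffunP=> b.
rewrite add_lfunE scale_lfunE !ffunE !RdeltaE scaler_sumr -big_split /=.
by apply: eq_bigr => h _; rewrite ev_lin mulrDl -mulrA.
Qed.

Lemma RdeltaG_lin : linear (@RdeltaG C G H K).
Proof.
move=> c F F'; rewrite /RdeltaG Rdelta_lin.
by rewrite comp_lfunDr comp_lfunDl comp_lfunZl comp_lfunZr.
Qed.

Lemma IopE (f : l2 C (G * G)%type) x y :
  Iop C H K f (x, y) = if mid H K x == grng y
    then f (x ** p1 (ginv (p2 x) ** y), ginv (p2 x) ** y) else 0.
Proof.
rewrite /Iop linfun_lin ?ffunE // => c u v; apply/ffunP=> -[a d].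
by rewrite !ffunE; case: ifP => _; rewrite ?ffunE // scaler0 addr0.
Qed.

Lemma midE g : mid H K g = grng (p2 g).
Proof. by have [_ _ e _] := p_dec g. Qed.

Definition Uop (b : box) : op C G := op_of (fun y y' =>
  [&& grng (top b) == grng y, p1 (ginv (top b) ** y) == right b
    & ginv (top b) ** y == y']%:R).

Lemma entry_RG (b : box) x x' : entry (RdeltaG (chi C H K (val b))) x x'
  = ((p2 x == top b) && (x ** right b == x'))%:R.
Proof. by rewrite /entry RdeltaG_chi ffunE -natrM mulnb. Qed.

Lemma entry_Iop x y x' y' : entry (Iop C H K) (x, y) (x', y')
  = [&& grng (p2 x) == grng y, x ** p1 (ginv (p2 x) ** y) == x'
      & ginv (p2 x) ** y == y']%:R.
Proof. by rewrite /entry IopE midE; case: eqP => // _; rewrite ffunE. Qed.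

Lemma src_p2 g : gsrc (p2 g) = gsrc g.
Proof. by have [_ _ e eg] := p_dec g; rewrite -[in RHS]eg gsrc_mul. Qed.

Lemma rng_p1 g : grng (p1 g) = grng g.
Proof. by have [_ _ e eg] := p_dec g; rewrite -[in RHS]eg grng_mul. Qed.

(* The pairs to which chi is applied are boxes. *)
Lemma bottomP (b : box) :
  [/\ bottom b \in K, left b \in H, gsrc (left b) = grng (bottom b),
      gsrc (bottom b) = gsrc (right b) & grng (left b) = grng (top b)].
Proof.
have [kK hH e] := boxP b; have [lH bK ac _] := p_dec (top b ** right b).
split=> //; first by rewrite -p2_mul_box src_p2 gsrc_mul.
by rewrite /left /lact rng_p1 grng_mul.
Qed.

Lemma vcomp_pair (b b' : box) :
  vcomposable b b' -> crossed_pair H K (vcomp b b').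
Proof.
move/eqP=> e; have [kK hH eb] := boxP b; have [_ hH' eb'] := boxP b'.
have [_ _ _ es _] := bottomP b.
have er : gsrc (right b) = grng (right b') by rewrite -es e.
case: mHK => [[HM _] _ _ _].
by rewrite /crossed_pair /= kK HM //= grng_mul // eb.
Qed.

Lemma hcomp_pair (b b' : box) :
  hcomposable b b' -> crossed_pair H K (hcomp b b').
Proof.
move/eqP=> e; have [kK hH eb] := boxP b; have [kK' hH' eb'] := boxP b'.
have [_ _ _ _ el] := bottomP b'.
have er : gsrc (top b) = grng (top b') by rewrite eb e el.
case: mHK => [_ [KM _] _ _].
by rewrite /crossed_pair /= hH' KM //= gsrc_mul // eb'.
Qed.

Lemma vinv_pair (b : box) : crossed_pair H K (vinv b).
Proof.
have [kK hH eb] := boxP b; have [bK _ _ es _] := bottomP b.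
case: mHK => [[_ HV] _ _ _].
by rewrite /crossed_pair /= bK HV //= grng_inv es.
Qed.

Lemma hvinv_pair (b : box) : crossed_pair H K (hvinv b).
Proof.
have [bK lH e _ _] := bottomP b.
case: mHK => [[_ HV] [_ KV] _ _].
by rewrite /crossed_pair /= KV // HV //= grng_inv gsrc_inv e.
Qed.

Lemma slice_IopE (omega : 'Hom(op C G, C^o)) : slice (Iop C H K) omega
  = \sum_b omega (Uop b) *: RdeltaG (chi C H K (val b)).
Proof.
apply: entry_inj => x x'; rewrite entry_op_of entry_sum.
transitivity (omega (\sum_(b | (p2 x == top b) && (x ** right b == x')) Uop b)).
  congr (omega _); apply: entry_inj => y y'.
  rewrite entry_op_of entry_Iop entry_sum.
  have [xK e] : p2 x \in K /\ gsrc (p2 x) = gsrc x.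
    by rewrite src_p2; case: (p_dec x).
  have [er|nr] := eqVneq (grng (p2 x)) (grng y); last first.
    rewrite big1 // => b /andP[/eqP tb _].
    by rewrite entry_op_of -tb (negPf nr).
  set z := ginv (p2 x) ** y.
  have rz : grng z = gsrc (p2 x) by rewrite grng_mul ?grng_inv ?gsrc_inv.
  have [zH _ _ _] := p_dec z.
  have ok : crossed_pair H K (p2 x, p1 z).
    by rewrite /crossed_pair /= xK zH rng_p1 rz eqxx.
  pose b0 : box := exist (crossed_pair H K) _ ok.
  have t0 : top b0 = p2 x by [].
  have r0 : right b0 = p1 z by [].
  have [ex|nx] /= := eqVneq (x ** p1 z) x'.
    rewrite (bigD1 b0) ?t0 ?r0 ?ex ?eqxx //= entry_op_of t0 r0 er !eqxx /=.
    rewrite big1 ?addr0 // => b /andP[/andP[/eqP tb _] nb].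
    rewrite entry_op_of -tb -/z; case: (p1 z =P right b) => [rb|]; last by rewrite andbF.
    by case/eqP: nb; apply: box_inj; rewrite ?t0 ?r0.
  rewrite big1 // => b /andP[/eqP tb /eqP xb]; rewrite entry_op_of -tb -/z.
  case: (p1 z =P right b) => [rb|]; last by rewrite andbF.
  by rewrite rb xb eqxx in nx.
rewrite linear_sum big_mkcond /=; apply: eq_bigr => b _.
by rewrite entryZ entry_RG; case: ifP => _; rewrite ?mulr1 ?mulr0.
Qed.

Lemma slice_adjE (omega : 'Hom(op C G, C^o)) : slice (opadj (Iop C H K)) omega
  = op_of (fun x x' =>
      \sum_(b : box | (top b == ginv (p2 x')) && (x' ** left b == x)) omega (Uop b)).
Proof.
apply: entry_inj => x x'; rewrite !entry_op_of -linear_sum.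
congr (omega _); apply: entry_inj => y y'.
rewrite !entry_op_of entry_Iop entry_sum conjC_nat.
have [_ kK _ _] := p_dec x'; set k := p2 x' in kK *.
have [_ [KM KV] _ _] := mHK.
have -> : [&& grng k == grng y', x' ** p1 (ginv k ** y') == x & ginv k ** y' == y]
   = [&& gsrc k == grng y, x' ** p1 y == x & k ** y == y'].
  apply/and3P/and3P => -[/eqP e1 /eqP e2 /eqP e3]; split; apply/eqP.
  - by rewrite -e3 grng_mul ?grng_inv ?gsrc_inv.
  - by rewrite -e3.
  - by rewrite -e3 gmulVK.
  - by rewrite -e3 grng_mul.
  - by rewrite -e3 gmulKV.
  - by rewrite -e3 gmulKV.
have [er|nr] := eqVneq (gsrc k) (grng y); last first.
  rewrite big1 // => b /andP[/eqP tb _].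
  by rewrite entry_op_of tb grng_inv (negPf nr).
have [hH uK eu eky] := p_dec (k ** y).
have rky : grng (p1 (k ** y)) = grng k by rewrite rng_p1 grng_mul.
have ok : crossed_pair H K (ginv k, p1 (k ** y)).
  by rewrite /crossed_pair /= KV // hH gsrc_inv rky eqxx.
pose b0 : box := exist (crossed_pair H K) _ ok.
have l0 : left b0 = p1 y.
  rewrite /left /lact /top /right /=.
  have ekp : gsrc (ginv k) = grng (p1 (k ** y)) by rewrite gsrc_inv rky.
  have [aH cK ac ea] := p_dec (ginv k ** p1 (k ** y)).
  have ey : y = ginv k ** p1 (k ** y) ** p2 (k ** y).
    by rewrite -gmulA // eky gmulKV.
  have ecu : gsrc (p2 (ginv k ** p1 (k ** y))) = grng (p2 (k ** y)).
    by rewrite src_p2 gsrc_mul.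
  rewrite [in RHS]ey -[in RHS]ea -gmulA // [RHS]p1M //.
    exact: KM.
  by rewrite grng_mul.
have t0 : top b0 = ginv k by [].
have r0 : right b0 = p1 (k ** y) by [].
have [ex|nx] /= := eqVneq (x' ** p1 y) x.
  rewrite (bigD1 b0) ?t0 ?l0 ?ex ?eqxx //= entry_op_of t0 r0 ginvK grng_inv er !eqxx /=.
  rewrite big1 ?addr0 // => b /andP[/andP[/eqP tb _] nb].
  rewrite entry_op_of tb ginvK.
  case: (p1 (k ** y) =P right b) => [rb|]; last by rewrite andbF.
  by case/eqP: nb; apply: box_inj; rewrite ?t0 ?r0.
rewrite big1 // => b /andP[/eqP tb /eqP xb]; rewrite entry_op_of tb ginvK.
case: (p1 (k ** y) =P right b) => [rb|]; last by rewrite andbF.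
have bb0 : b = b0 by apply: box_inj; rewrite ?t0 ?r0.
by rewrite bb0 l0 in xb; rewrite xb eqxx in nx.
Qed.

Lemma lfun1_Uop : \1%VF = \sum_(b : box | gunit (top b)) Uop b.
Proof.
apply: entry_inj => y y'; rewrite entry_sum /entry lfunE /= ffunE.
have [hH _ _ _] := p_dec y.
have rK : grng y \in K by rewrite -gsrc_inv; case/andP: (src_in (ginv y)).
have ok : crossed_pair H K (grng y, p1 y).
  by rewrite /crossed_pair /= rK hH rng_p1 gsrc_rng eqxx.
pose b0 : box := exist (crossed_pair H K) _ ok.
have t0 : top b0 = grng y by [].
have r0 : right b0 = p1 y by [].
have iu (u : G) : gunit u -> ginv u = u.
  move=> uu; apply/esym/ginv_uniq; first by rewrite gunit_rng // (eqP uu).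
  by rewrite gunit_mul // gunit_rng // (eqP uu).
have u0 : gunit (grng y) by rewrite /gunit gsrc_rng.
rewrite (bigD1 b0) ?t0 //= -/(entry _ _ _) entry_op_of t0 r0 iu // grng_rng.
rewrite gmul_rng !eqxx /= big1 ?addr0 // => b /andP[ub nb].
rewrite -/(entry _ _ _) entry_op_of (gunit_rng ub).
case: eqP => //= tb; rewrite tb iu // gmul_rng.
case: (p1 y =P right b) => //= rb.
by case/eqP: nb; apply: box_inj; rewrite ?t0 ?r0.
Qed.

Lemma omega_Uop (omega : 'Hom(op C G, C^o)) (b : box) :
  omega (Uop b) = entry (slice (Iop C H K) omega) (top b) (top b ** right b).
Proof.
have [kK hH e] := boxP b.
rewrite slice_IopE entry_sum (bigD1 b) //= entryZ entry_RG p2K // !eqxx mulr1.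
rewrite big1 ?addr0 // => d nd; rewrite entryZ entry_RG p2K //.
case: (top b =P top d) => [td|]; last by rewrite mulr0.
case: eqP => [ed|]; last by rewrite mulr0.
case/eqP: nd; apply: box_inj; first by [].
by apply: (@gmulI _ (top b)) => //; rewrite td; case: (boxP d).
Qed.

Lemma sliceIE (omega : 'Hom(op C G, C^o)) : sliceI C H K omega = slice (Iop C H K) omega.
Proof. by rewrite /sliceI linfun_lin //; apply: slice_lin. Qed.

Lemma sliceI_inv (omega : 'Hom(op C G, C^o)) (b : box) :
  ((sliceI C H K)^-1%VF (slice (Iop C H K) omega)) (Uop b) = omega (Uop b).
Proof.
rewrite !omega_Uop -sliceIE limg_lfunVK ?sliceIE //.
by rewrite -sliceIE memv_img ?memvf.
Qed.

Lemma kappa_slice (omega : 'Hom(op C G, C^o)) :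
  kappa H K (slice (Iop C H K) omega) = slice (opadj (Iop C H K)) omega.
Proof.
rewrite /kappa !slice_adjE; apply: entry_inj => x x'; rewrite !entry_op_of.
by apply: eq_bigr => b _; apply: sliceI_inv.
Qed.

Lemma eps_slice (omega : 'Hom(op C G, C^o)) : eps H K (slice (Iop C H K) omega) = omega \1%VF.
Proof.
rewrite /eps lfun1_Uop !linear_sum; apply: eq_bigr => b _; exact: sliceI_inv.
Qed.

Lemma crossed_Shat : crossed C H K = Shat C H K.
Proof.
have RE F : linfun (@RdeltaG C G H K) F = RdeltaG F.
  by apply: linfun_lin; apply: RdeltaG_lin.
apply/eqP; rewrite eqEsubv; apply/andP; split; apply/subvP => T /memv_imgP[].
  move=> F _ ->; rewrite RE.
  pose om : 'Hom(op C G, C^o) :=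
    linfun (fun T : op C G =>
      \sum_b F b * entry T (top b ** right b) (right b) : C^o).
  have omE S : om S = \sum_b F b * entry S (top b ** right b) (right b).
    rewrite /om linfun_lin // => c U V; rewrite scaler_sumr -big_split /=.
    by apply: eq_bigr => b _; rewrite entry_lin mulrDr mulrCA.
  have omU b : om (Uop b) = F b.
    have [kK hH e] := boxP b.
    rewrite omE (bigD1 b) //= entry_op_of grng_mul // gmulKV // p1H // !eqxx mulr1.
    rewrite big1 ?addr0 // => d nd; rewrite entry_op_of.
    have [kK' hH' e'] := boxP d.
    rewrite grng_mul //; case: eqP => [er|]; last by rewrite mulr0.
    case: (ginv (top b) ** (top d ** right d) =P right d) => [ed|]; last first.
      by rewrite !andbF mulr0.
    rewrite ed p1H //; case: eqP => [r_eq|]; last by rewrite mulr0.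
    case/eqP: nd; apply: mul_box_inj.
    by rewrite -r_eq -{2}ed gmulVK // grng_mul.
  apply/memv_imgP; exists om; first by rewrite memvf.
  rewrite sliceIE slice_IopE; under eq_bigr => b _ do rewrite omU -RE -linearZ.
  rewrite -linear_sum -RE; congr (_ _); apply/ffunP=> b.
  rewrite sum_ffunE (bigD1 b) //= !ffunE eqxx big1 ?addr0.
    by rewrite /GRing.scale /= mulr1.
  move=> d nd; rewrite !ffunE (inj_eq val_inj) eq_sym (negPf nd).
  by rewrite /GRing.scale /= mulr0.
move=> om _ ->; rewrite sliceIE slice_IopE memv_suml // => b _.
by rewrite memvZ // -RE memv_img ?memvf.
Qed.

End MatchPairTheory.

Section TensorFacts.

Lemma tlift_lin (D : fieldType) (A B : vectType D) (V : lmodType D)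
    (f : A -> B -> V) : linear (tlift f).
Proof.
move=> c s t; rewrite /tlift scaler_sumr -big_split /=; apply: eq_bigr => i _.
rewrite scaler_sumr -big_split /=; apply: eq_bigr => j _.
by rewrite !mxE scalerDl scalerA.
Qed.

Lemma tlift_tens (D : fieldType) (A B : vectType D) (V : lmodType D)
    (f : A -> B -> V) (a : A) (b : B) :
    (forall b, linear (f^~ b)) -> (forall a, linear (f a)) ->
  tlift f (tens a b) = f a b.
Proof.
move=> fl fr.
pose fL b : {linear A -> V} :=
  HB.pack (f^~ b) (GRing.isLinear.Build D A V _ (f^~ b) (fl b)).
pose fR a : {linear B -> V} :=
  HB.pack (f a) (GRing.isLinear.Build D B V _ (f a) (fr a)).
rewrite /tlift -[RHS]/(fL b a) [in RHS](coord_vbasis (memvf a)) linear_sum.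
apply: eq_bigr => i _; rewrite linearZ -[fL b _]/(fR _ b) /=.
rewrite -[RHS]/(_ *: fR _ b).
rewrite [in RHS](coord_vbasis (memvf b)) linear_sum scaler_sumr.
by apply: eq_bigr => j _; rewrite linearZ mxE scalerA.
Qed.

Variable G : finGroupoid.

Lemma tens_op_tens (S T : op C G) : tens_op C G (tens S T) = optens S T.
Proof.
rewrite /tens_op linfun_lin; last exact: tlift_lin.
apply: tlift_tens => U c V W; apply: entry_inj => x y.
  rewrite entryD entryZ !entry_op_of entryD entryZ.
  by rewrite mulrDl mulrA.
rewrite entryD entryZ !entry_op_of entryD entryZ.
by rewrite mulrDr mulrCA.
Qed.

Lemma tens_op_bij :
  lker (tens_op C G) == 0%VS /\ limg (tens_op C G) = fullv.
Proof.
have im : limg (tens_op C G) = fullv.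
  apply/eqP; rewrite eqEsubv subvf; apply/subvP => T _.
  pose E (x y : G) : op C G := op_of (fun x' y' => ((x' == x) && (y' == y))%:R).
  have -> : T = \sum_p \sum_q entry T p q *: optens (E p.1 q.1) (E p.2 q.2).
    apply: entry_inj => p q; rewrite entry_sum (bigD1 p) //= entry_sum (bigD1 q) //=.
    have ee p' q' : entry (optens (E p'.1 q'.1) (E p'.2 q'.2)) p q
        = ((p == p') && (q == q'))%:R.
      rewrite !entry_op_of -natrM mulnb -!pair_eqE /pair_eq /=.
      by rewrite andbACA.
    rewrite entryZ ee !eqxx mulr1 big1 ?addr0; last first.
      by move=> q' nq; rewrite entryZ ee [q == _]eq_sym (negPf nq) andbF mulr0.
    rewrite big1 ?addr0 // => p' np; rewrite entry_sum big1 // => q' _.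
    by rewrite entryZ ee [p == _]eq_sym (negPf np) mulr0.
  apply: memv_suml => p _; apply: memv_suml => q _; apply: memvZ.
  by rewrite -tens_op_tens memv_img ?memvf.
split=> //.
have := limg_ker_dim (tens_op C G) fullv; rewrite im capfv => e.
have dX (X : finType) : dim (l2 C X) = #|X| by exact: muln1.
have dop (X : finType) : \dim {: op C X} = (#|X| * #|X|)%N.
  by rewrite dimvf -!dX.
have dt : \dim {: tensor (op C G) (op C G)}
    = (\dim {: op C G} * \dim {: op C G})%N by rewrite dimvf.
move: e; rewrite dt !dop card_prod => e.
rewrite -dimv_eq0 -(eqn_add2r (#|G| * #|G| * (#|G| * #|G|))%N) add0n.
exact/eqP.
Qed.

End TensorFacts.

End WellDefined.

(* Main.v *)
Require Import Defs.
From mathcomp Require Import all_boot all_order all_algebra.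
From mathcomp Require Import reals complex classical_sets ring.
Import Order.TTheory GRing.Theory Num.Theory.
Local Open Scope ring_scope.

Set Implicit Arguments.
Unset Strict Implicit.
Unset Printing Implicit Defensive.

(** A box is determined by any two adjacent edges, because every arrow of the
  groupoid factors uniquely through the match pair, in either order.  Hence the
  boxes form two groupoids, with the vertical and the horizontal composition,
  linked by the interchange law [vmul_hquo].

  The functions on the boxes act on [l2 box] by right translation in the
  vertical groupoid: [Rdelta (chi b)] sends [xi] to
  [d |-> xi (d b)], supported by the boxes [d] whose bottom edge is the top edge
  of [b] ([Rdelta_chiE]).  This representation is faithful, is multiplicative
  for the vertical composition and turns the vertical inverse into the adjoint;
  so all the algebraic laws of the algebra of boxes are inherited from operators,
  and the operator norm pulled back along it is a C*-norm ([cstar_norm_repr]).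
  Conjugating by the bijection [(k, h) |-> kh] gives the same facts on [l2 G].

  The coproduct of a box is the sum of its horizontal factorizations.  A
  factorization is given by its right factor [c], an arbitrary box with the same
  right edge, the left factor being the quotient [hquo b c].  In this form
  coassociativity is a change of variable in the horizontal groupoid,
  multiplicativity is the interchange law together with the uniqueness of a box
  with given top and right edges, and the laws of the counit and of the antipode
  hold because a box is a horizontal identity as soon as its top edge is a unit.
  These computations use only the structure constants on the boxes, so they are
  made once, for an algebra with a spanning family of boxes
  ([weak_hopf_of_boxes]), and used for the algebra of the double groupoid and for
  the crossed product.

  For the crossed product the structure constants come from the multiplicative
  partial isometry.  It acts as a partial bijection of [G * G], whose
  inverse is the adjoint ([opadj_IopE]); evaluating the conjugate of
  [1 (x) Rdelta (chi b)] at a point [(x, y)] shows that it is supported by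
  [p2 x ** p2 y = top b], which singles out one horizontal factorization of [b]
  ([Gamma_chi]).  For the antipode and the counit, [Rdelta (chi b)] is a slice of
  the isometry along a linear form which is the coordinate of [b]
  ([slice_repr]). *)

(** * Multilinear algebra on tensor products *)

Section Semilinear.
Variable D : fieldType.

(** The cases of interest are the identity, for linear maps, and the complex
  conjugation, for the involutions. *)
Definition semilinear_over (sigma : D -> D) (U V : lmodType D) (f : U -> V) :=
  forall c x y, f (c *: x + y) = sigma c *: f x + f y.

Definition bilinear_map (A B V : lmodType D) (f : A -> B -> V) :=
  (forall b, linear (f^~ b)) /\ (forall a, linear (f a)).

Lemma semilin0 sigma (U V : lmodType D) (f : U -> V) :
  sigma 1 = 1 -> semilinear_over sigma f -> f 0 = 0.
Proof.
move=> s1 fl; apply: (@addrI _ (f 0)).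
by rewrite addr0 -{1}[f 0]scale1r -s1 -fl scaler0 addr0.
Qed.

Lemma semilinZ sigma (U V : lmodType D) (f : U -> V) c x :
  sigma 1 = 1 -> semilinear_over sigma f -> f (c *: x) = sigma c *: f x.
Proof. by move=> s1 fl; have := fl c x 0; rewrite (semilin0 s1 fl) !addr0. Qed.

Lemma semilin_sum sigma (U V : lmodType D) (f : U -> V) (I : Type) (r : seq I)
    (P : pred I) (F : I -> U) : sigma 1 = 1 -> semilinear_over sigma f ->
  f (\sum_(i <- r | P i) F i) = \sum_(i <- r | P i) f (F i).
Proof.
move=> s1 fl; apply: (big_morph f _ (semilin0 s1 fl)) => x y.
by have := fl 1 x y; rewrite s1 !scale1r.
Qed.

Lemma lin0 (U V : lmodType D) (f : U -> V) : linear f -> f 0 = 0.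
Proof. by move=> fl; apply: (@semilin0 id). Qed.

Lemma linZ (U V : lmodType D) (f : U -> V) c x :
  linear f -> f (c *: x) = c *: f x.
Proof. by move=> fl; apply: (@semilinZ id). Qed.

Lemma linD (U V : lmodType D) (f : U -> V) x y : linear f -> f (x + y) = f x + f y.
Proof. by move=> fl; rewrite -[x]scale1r fl !scale1r. Qed.

Lemma lin_sum (U V : lmodType D) (f : U -> V) (I : Type) (r : seq I)
    (P : pred I) (F : I -> U) : linear f ->
  f (\sum_(i <- r | P i) F i) = \sum_(i <- r | P i) f (F i).
Proof. by move=> fl; apply: (@semilin_sum id). Qed.

Lemma lin_comp (U V W : lmodType D) (g : V -> W) (f : U -> V) :
  linear g -> linear f -> linear (fun x => g (f x)).
Proof. by move=> gl fl c x y; rewrite fl gl. Qed.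

End Semilinear.

Section TensorCalculus.
Variable D : fieldType.

(** The universal property, in the form used throughout: a map out of a tensor
  product is computed on elementary tensors. *)
Lemma tlift_tens_bilin (A B : vectType D) (V : lmodType D) (f : A -> B -> V) a b :
  bilinear_map f -> tlift f (tens a b) = f a b.
Proof. by case=> fl fr; apply: tlift_tens. Qed.

Lemma tens_bilin (A B : vectType D) : bilinear_map (@tens D A B).
Proof.
split=> [b|a] c x y; apply/matrixP=> i j; rewrite !mxE linearP.
  by rewrite mulrDl mulrA.
by rewrite mulrDr mulrCA.
Qed.

Lemma tlift_param (A B : vectType D) (U V : lmodType D) (f : U -> A -> B -> V) t :
  (forall a b, linear (fun u => f u a b)) -> linear (fun u => tlift (f u) t).
Proof.
move=> fl c x y; rewrite /tlift scaler_sumr -big_split /=; apply: eq_bigr => i _.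
rewrite scaler_sumr -big_split /=; apply: eq_bigr => j _.
by rewrite fl scalerDr !scalerA mulrC.
Qed.

Lemma tlift_sum (A B : vectType D) (V : lmodType D) (f : A -> B -> V)
    (I : Type) (r : seq I) (P : pred I) (F : I -> tensor A B) :
  tlift f (\sum_(i <- r | P i) F i) = \sum_(i <- r | P i) tlift f (F i).
Proof. exact: lin_sum (tlift_lin f). Qed.

Lemma tmap_lin (A A' B B' : vectType D) (f : A -> A') (g : B -> B') :
  linear (tmap f g).
Proof. exact: tlift_lin. Qed.

Lemma tmap_tens (A A' B B' : vectType D) (f : A -> A') (g : B -> B') a b :
  linear f -> linear g -> tmap f g (tens a b) = tens (f a) (g b).
Proof.
move=> fl gl; apply: tlift_tens_bilin; split=> [b'|a'].
  exact: lin_comp ((tens_bilin _ _).1 _) fl.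
exact: lin_comp ((tens_bilin _ _).2 _) gl.
Qed.

Lemma tassoc_lin (A B E : vectType D) : linear (@tassoc D A B E).
Proof. exact: tlift_lin. Qed.

Lemma tassoc_tens (A B E : vectType D) (a : A) (b : B) (d : E) :
  tassoc (tens a (tens b d)) = tens (tens a b) d.
Proof.
rewrite /tassoc tlift_tens_bilin; last first.
  split=> [t|a']; last exact: tlift_lin.
  apply: tlift_param => b' d'.
  exact: lin_comp ((tens_bilin _ _).1 _) ((tens_bilin _ _).1 _).
apply: tlift_tens_bilin; split=> [d'|b']; last exact: (tens_bilin _ _).2.
exact: lin_comp ((tens_bilin _ _).1 _) ((tens_bilin _ _).2 _).
Qed.

Lemma tmul_bilin (A B : vectType D) (mA : A -> A -> A) (mB : B -> B -> B) :
  bilinear_map (tmul mA mB).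
Proof.
split=> [t|s]; first exact: tlift_lin.
by apply: tlift_param => a b; apply: tlift_lin.
Qed.

Lemma tmul_tens (A B : vectType D) (mA : A -> A -> A) (mB : B -> B -> B) a b c d :
  bilinear_map mA -> bilinear_map mB ->
  tmul mA mB (tens a b) (tens c d) = tens (mA a c) (mB b d).
Proof.
move=> [mAl mAr] [mBl mBr]; have [tl tr] := tens_bilin A B.
rewrite /tmul tlift_tens_bilin; last first.
  split=> [b'|a'] /=; apply: tlift_param => c' d'.
    exact: lin_comp (tl _) (mAl _).
  exact: lin_comp (tr _) (mBl _).
apply: tlift_tens_bilin; split=> [d'|c'].
  exact: lin_comp (tl _) (mAr _).
exact: lin_comp (tr _) (mBr _).
Qed.

Lemma mem_tensv (A : vectType D) (V : {vspace A}) a b :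
  a \in V -> b \in V -> tens a b \in tensv V.
Proof.
have [tl tr] := tens_bilin A A.
move=> aV bV; rewrite (coord_vbasis aV) (coord_vbasis bV).
rewrite (lin_sum _ _ _ (tl _)) memv_suml // => i _; rewrite (linZ _ _ (tl _)) memvZ //.
rewrite (lin_sum _ _ _ (tr _)) memv_suml // => j _; rewrite (linZ _ _ (tr _)) memvZ //.
by apply: memv_span; apply: allpairs_f; apply: mem_nth; rewrite size_tuple.
Qed.

End TensorCalculus.

Section TensorStar.
Variable C : numClosedFieldType.

(** For antilinear [f] and [g], the antilinear extension of
  [a (x) b |-> f a (x) g b]; conjugating the coordinates first makes it
  independent of the basis ([tconj_map_tens]). *)
Definition tconj_map (A B : vectType C) (f : A -> A) (g : B -> B) (t : tensor A B) :
    tensor A B :=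
  tmap f g (map_mx (fun c : C => c^*) (t : 'M_(_, _))).

Lemma tconj_map_semilin (A B : vectType C) (f : A -> A) (g : B -> B) :
  semilinear_over (fun c : C => c^*) (tconj_map f g).
Proof.
move=> c s t; rewrite /tconj_map -tmap_lin; congr (tmap _ _ _).
by apply/matrixP=> i j; rewrite !mxE rmorphD rmorphM.
Qed.

Lemma tconj_map_tens (A B : vectType C) (f : A -> A) (g : B -> B) a b :
  semilinear_over (fun c : C => c^*) f -> semilinear_over (fun c : C => c^*) g ->
  tconj_map f g (tens a b) = tens (f a) (g b).
Proof.
move=> fl gl; have c1 := rmorph1 (@Num.conj C).
have [tl tr] := tens_bilin A B.
rewrite [a in RHS](coord_vbasis (memvf a)) [b in RHS](coord_vbasis (memvf b)).
rewrite (semilin_sum _ _ _ c1 fl) (semilin_sum _ _ _ c1 gl).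
rewrite (lin_sum _ _ _ (tl _)) /tconj_map /tmap /tlift; apply: eq_bigr => i _.
rewrite (lin_sum _ _ _ (tr _)); apply: eq_bigr => j _.
rewrite !mxE rmorphM (semilinZ _ _ c1 fl) (semilinZ _ _ c1 gl).
by rewrite (linZ _ _ (tl _)) (linZ _ _ (tr _)) scalerA.
Qed.

End TensorStar.

(** * The *-algebra of operators and its norm *)

Section Operators.
Variable C : numClosedFieldType.
Implicit Types X : finType.

Lemma op_entryE X (T : op C X) (v : l2 C X) x : T v x = \sum_y entry T x y * v y.
Proof.
have -> : T = op_of (entry T) by apply: entry_inj => y z; rewrite entry_op_of.
by rewrite op_ofE; under [RHS]eq_bigr do rewrite entry_op_of.
Qed.

Lemma entry_comp X (S T : op C X) x y :
  entry (S \o T)%VF x y = \sum_z entry S x z * entry T z y.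
Proof. by rewrite /entry comp_lfunE op_entryE. Qed.

Lemma entry1 X (x y : X) : entry (\1%VF : op C X) x y = (x == y)%:R.
Proof. by rewrite /entry lfunE /= ffunE. Qed.

Lemma entry_adj X (T : op C X) x y : entry (opadj T) x y = (entry T y x)^*.
Proof. exact: entry_op_of. Qed.

Lemma opadj_semilin X : semilinear_over (fun c : C => c^*) (@opadj C X).
Proof.
move=> c S T; apply: entry_inj => x y.
by rewrite entryD entryZ !entry_adj entryD entryZ rmorphD rmorphM.
Qed.

Lemma opadjK X : involutive (@opadj C X).
Proof. by move=> T; apply: entry_inj => x y; rewrite !entry_adj conjCK. Qed.

Lemma opadjM X (S T : op C X) : opadj (S \o T)%VF = (opadj T \o opadj S)%VF.
Proof.
apply: entry_inj => x y; rewrite entry_adj !entry_comp rmorph_sum.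
by apply: eq_bigr => z _; rewrite rmorphM !entry_adj mulrC.
Qed.

Definition dotp X (u v : l2 C X) : C := \sum_x u x * (v x)^*.

Definition hnorm X (v : l2 C X) : C := sqrtC (dotp v v).

Lemma dotp_lin X (v : l2 C X) : scalar (fun u : l2 C X => dotp u v).
Proof.
move=> c u w; rewrite /dotp mulr_sumr -big_split; apply: eq_bigr => x _.
by rewrite !ffunE mulrDl -mulrA.
Qed.

Lemma dotpC X (u v : l2 C X) : (dotp u v)^* = dotp v u.
Proof.
rewrite /dotp rmorph_sum; apply: eq_bigr => x _.
by rewrite rmorphM /= conjCK mulrC.
Qed.

Lemma dotp_ge0 X (v : l2 C X) : 0 <= dotp v v.
Proof. by apply: sumr_ge0 => x _; apply: mul_conjC_ge0. Qed.

Lemma dotp_eq0 X (v : l2 C X) : dotp v v = 0 -> v = 0.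
Proof.
move/eqP; rewrite psumr_eq0 => [/allP h|x _]; last exact: mul_conjC_ge0.
apply/ffunP=> x; rewrite ffunE; have := h x; rewrite mem_index_enum => /(_ isT).
by rewrite mul_conjC_eq0 => /eqP.
Qed.

Lemma dotp_comb X (u v : l2 C X) (a b : C) :
  dotp (a *: u + b *: v) (a *: u + b *: v)
  = a * a^* * dotp u u + a * b^* * dotp u v + (b * a^* * dotp v u + b * b^* * dotp v v).
Proof.
have r w w' c : dotp w (c *: w') = c^* * dotp w w'.
  rewrite -dotpC -[c *: w']addr0 dotp_lin rmorphD rmorphM /= !dotpC.
  by rewrite /dotp [X in _ + X]big1 ?addr0 // => x _; rewrite ffunE conjC0 mulr0.
have d w w1 w2 : dotp w (w1 + w2) = dotp w w1 + dotp w w2.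
  by rewrite -dotpC -[w1]scale1r dotp_lin rmorphD rmorphM /= !dotpC conjC1 mul1r scale1r.
have rl w w' c : dotp (c *: w) w' = c * dotp w w'.
  by rewrite -dotpC r rmorphM /= conjCK dotpC.
rewrite dotp_lin !d !r !rl mulrDr !mulrA.
by rewrite [a^* * b]mulrC [b^* * b]mulrC.
Qed.

(** The square norm of [<v,v> u - <u,v> v] is nonnegative, and equals
  [<v,v> (<u,u> <v,v> - |<u,v>|^2)]. *)
Lemma cauchy_schwarz X (u v : l2 C X) :
  `|dotp u v| ^+ 2 <= dotp u u * dotp v v.
Proof.
have [e|nz] := eqVneq (dotp v v) 0.
  rewrite (dotp_eq0 e) /dotp big1 ?normr0 ?expr0n ?mulr0n; last first.
    by move=> x _; rewrite ffunE conjC0 mulr0.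
  by rewrite [X in _ * X]big1 ?mulr0 // => x _; rewrite ffunE conjC0 mulr0.
have a0 : 0 < dotp v v by rewrite lt_def nz dotp_ge0.
have := dotp_ge0 (dotp v v *: u + (- dotp u v) *: v).
rewrite dotp_comb rmorphN /= !dotpC -[dotp v u]dotpC normCK.
set a := dotp v v; set b := dotp u v; set c := dotp u u.
have -> : a * a * c + a * - b^* * b + (- b * a * b^* + - b * - b^* * a)
   = a * (c * a - b * b^*) by ring.
by rewrite pmulr_rge0 // subr_ge0.
Qed.

Lemma hnorm_ge0 X (v : l2 C X) : 0 <= hnorm v.
Proof. by rewrite sqrtC_ge0 dotp_ge0. Qed.

Lemma hnorm_eq0 X (v : l2 C X) : hnorm v = 0 -> v = 0.
Proof. by move/eqP; rewrite sqrtC_eq0 => /eqP/dotp_eq0. Qed.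

Lemma sqr_hnorm X (v : l2 C X) : hnorm v ^+ 2 = dotp v v.
Proof. exact: sqrtCK. Qed.

Lemma hnorm_dotp X (u v : l2 C X) : `|dotp u v| <= hnorm u * hnorm v.
Proof.
rewrite -(@ler_pXn2r _ 2) ?nnegrE ?mulr_ge0 ?hnorm_ge0 // exprMn !sqr_hnorm.
exact: cauchy_schwarz.
Qed.

Lemma hnormZ X c (v : l2 C X) : hnorm (c *: v) = `|c| * hnorm v.
Proof.
apply/eqP; rewrite -(@eqrXn2 _ 2) ?mulr_ge0 ?hnorm_ge0 // exprMn !sqr_hnorm.
have := dotp_comb v 0 c 0; rewrite scaler0 addr0 => ->.
by rewrite !mul0r conjC0 mulr0 mul0r !addr0 normCK.
Qed.

Lemma hnormD X (u v : l2 C X) : hnorm (u + v) <= hnorm u + hnorm v.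
Proof.
rewrite -(@ler_pXn2r _ 2) ?nnegrE ?addr_ge0 ?hnorm_ge0 // sqrrD !sqr_hnorm.
have := dotp_comb u v 1 1; rewrite !scale1r conjC1 !mul1r => ->.
rewrite addrA lerD2r -addrA lerD2l -dotpC mulr2n.
set b := dotp v u; have hb : `|b| <= hnorm u * hnorm v by rewrite mulrC hnorm_dotp.
have hr : b^* + b \is Num.real by rewrite CrealE rmorphD /= conjCK addrC.
apply: le_trans (real_ler_norm hr) _; apply: le_trans (ler_normD _ _) _.
by rewrite norm_conjC lerD.
Qed.

Lemma dotp_adj X (T : op C X) u v : dotp (T u) v = dotp u (opadj T v).
Proof.
rewrite /dotp; under eq_bigr => x _ do rewrite op_entryE mulr_suml.
rewrite exchange_big; apply: eq_bigr => y _.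
rewrite op_entryE rmorph_sum mulr_sumr; apply: eq_bigr => x _.
by rewrite rmorphM entry_adj /= conjCK mulrCA mulrA.
Qed.

(** In finite dimension the sum of the norms of the columns is a bound. *)
Lemma op_bounded X (T : op C X) :
  exists2 M : C, 0 <= M & forall v, hnorm (T v) <= M * hnorm v.
Proof.
exists (\sum_y hnorm (T (dirac C y))) => [|v].
  by apply: sumr_ge0 => y _; apply: hnorm_ge0.
have -> : T v = \sum_y v y *: T (dirac C y).
  apply/ffunP=> x; rewrite op_entryE sum_ffunE; apply: eq_bigr => y _.
  by rewrite ffunE mulrC.
rewrite mulr_suml; elim/big_ind2: _ => [|u a w b hu hw|y _].
- by rewrite -[X in hnorm X](scale0r 0) hnormZ normr0 mul0r.
- exact: le_trans (hnormD _ _) (lerD hu hw).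
rewrite hnormZ mulrC ler_wpM2l ?hnorm_ge0 //.
rewrite -(@ler_pXn2r _ 2) ?nnegrE ?hnorm_ge0 // sqr_hnorm normCK /dotp.
rewrite (bigD1 y) //= lerDl; apply: sumr_ge0 => z _; exact: mul_conjC_ge0.
Qed.

End Operators.

Section OperatorNorm.
Variable R : realType.
Local Notation C := R[i].
Local Open Scope classical_set_scope.
Implicit Types X : finType.

(** The operator norm is the least bound; as the norm of a finite-dimensional
  operator is to be a complex number, it is the image of a real infimum. *)
Definition op_bounds X (T : op C X) : set R :=
  [set M | 0 <= M /\ forall v, hnorm (T v) <= M%:C%C * hnorm v].

Definition opnorm X (T : op C X) : C := (inf (op_bounds T))%:C%C.

Lemma op_bounds_nonempty X (T : op C X) : op_bounds T !=set0.
Proof.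
have [M M0 hM] := op_bounded T.
have e : M = (complex.Re M)%:C%C by rewrite RRe_real ?ger0_real.
by exists (complex.Re M); split; [rewrite -ler0c -e|rewrite -e].
Qed.

Lemma op_bounds_lb X (T : op C X) : has_lbound (op_bounds T).
Proof. by exists 0 => M []. Qed.

Lemma opnorm_ge0 X (T : op C X) : 0 <= opnorm T.
Proof.
rewrite ler0c; apply: lb_le_inf; first exact: op_bounds_nonempty.
by move=> M [].
Qed.

Lemma opnorm_le X (T : op C X) (M : C) :
  0 <= M -> (forall v, hnorm (T v) <= M * hnorm v) -> opnorm T <= M.
Proof.
move=> M0; have -> : M = (complex.Re M)%:C%C by rewrite RRe_real ?ger0_real.
move=> hM; rewrite lecR; apply: ge_inf; first exact: op_bounds_lb.
by split=> //; rewrite -ler0c RRe_real ?ger0_real.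
Qed.

(** The bounds of [T] form a closed half-line: each [v] gives the lower bound
  [|T v| / |v|] of all of them, hence of their infimum. *)
Lemma opnormP X (T : op C X) v : hnorm (T v) <= opnorm T * hnorm v.
Proof.
have [e|nz] := eqVneq (hnorm v) 0.
  by rewrite (hnorm_eq0 e) linear0 -[X in hnorm X](scale0r 0) hnormZ normr0 mul0r mulr0.
have h0 : 0 < hnorm v by rewrite lt_def nz hnorm_ge0.
rewrite -ler_pdivrMr //.
set q := _ / _; have q0 : 0 <= q by rewrite divr_ge0 ?hnorm_ge0.
have -> : q = (complex.Re q)%:C%C by rewrite RRe_real ?ger0_real.
rewrite lecR; apply: lb_le_inf; first exact: op_bounds_nonempty.
move=> M [_ hM]; rewrite -lecR RRe_real ?ger0_real //.
by rewrite ler_pdivrMr.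
Qed.

Lemma opnorm_eq0 X (T : op C X) : opnorm T = 0 -> T = 0.
Proof.
move=> e; apply/lfunP=> v; rewrite lfunE /=; apply: hnorm_eq0.
by apply/le_anti; rewrite hnorm_ge0 andbT -(mul0r (hnorm v)) -e opnormP.
Qed.

Lemma opnormZ_le X (c : C) (T : op C X) : opnorm (c *: T) <= `|c| * opnorm T.
Proof.
apply: opnorm_le => [|v]; first by rewrite mulr_ge0 ?opnorm_ge0.
by rewrite lfunE /= hnormZ -mulrA ler_wpM2l ?opnormP.
Qed.

Lemma opnormZ X (c : C) (T : op C X) : opnorm (c *: T) = `|c| * opnorm T.
Proof.
apply/le_anti; rewrite opnormZ_le /=; have [->|nz] := eqVneq c 0.
  by rewrite normr0 mul0r opnorm_ge0.
rewrite mulrC -ler_pdivlMr ?normr_gt0 // mulrC -normfV.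
by apply: le_trans (opnormZ_le _ _); rewrite scalerA mulVf // scale1r.
Qed.

Lemma opnormD X (S T : op C X) : opnorm (S + T) <= opnorm S + opnorm T.
Proof.
apply: opnorm_le => [|v]; first by rewrite addr_ge0 ?opnorm_ge0.
rewrite lfunE /= mulrDl; apply: le_trans (hnormD _ _) _.
by rewrite lerD ?opnormP.
Qed.

Lemma opnormM X (S T : op C X) : opnorm (S \o T)%VF <= opnorm S * opnorm T.
Proof.
apply: opnorm_le => [|v]; first by rewrite mulr_ge0 ?opnorm_ge0.
rewrite comp_lfunE; apply: le_trans (opnormP _ _) _.
by rewrite -mulrA ler_wpM2l ?opnorm_ge0 ?opnormP.
Qed.

(** [|T v|^2 = <v, T* T v>], which the Cauchy-Schwarz inequality bounds by
  [|T* T| |v|^2]. *)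
Lemma sqr_opnorm_le X (T : op C X) : opnorm T ^+ 2 <= opnorm (opadj T \o T)%VF.
Proof.
set n := opnorm (_ \o _)%VF; have n0 : 0 <= n by apply: opnorm_ge0.
rewrite -[n]sqrtCK ler_pXn2r ?nnegrE ?opnorm_ge0 ?sqrtC_ge0 //.
apply: opnorm_le => [|v]; first by rewrite sqrtC_ge0.
rewrite -(@ler_pXn2r _ 2) ?nnegrE ?mulr_ge0 ?hnorm_ge0 ?sqrtC_ge0 //.
rewrite exprMn (sqrtCK n) (sqr_hnorm (T v)) dotp_adj -(ger0_norm (x := dotp v _)); last first.
  by rewrite -dotp_adj dotp_ge0.
apply: le_trans (hnorm_dotp _ _) _; rewrite -comp_lfunE expr2 mulrA [n * _]mulrC -mulrA.
by rewrite ler_wpM2l ?hnorm_ge0 ?opnormP.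
Qed.

(** Divide [|T|^2 <= |T* T| <= |T*| |T|] by [|T|]. *)
Lemma opnorm_adj_le X (T : op C X) : opnorm T <= opnorm (opadj T).
Proof.
have [->|nz] := eqVneq (opnorm T) 0; first exact: opnorm_ge0.
have n0 : 0 < opnorm T by rewrite lt_def nz opnorm_ge0.
rewrite -(ler_pM2r n0) -expr2.
exact: le_trans (sqr_opnorm_le T) (opnormM _ _).
Qed.

Lemma opnorm_cstar X (T : op C X) : opnorm (opadj T \o T)%VF = opnorm T ^+ 2.
Proof.
apply/le_anti; rewrite sqr_opnorm_le andbT; apply: le_trans (opnormM _ _) _.
rewrite expr2 ler_wpM2r ?opnorm_ge0 //.
by rewrite -[in leRHS](opadjK T) opnorm_adj_le.
Qed.

(** Covers the concrete algebras of operators, with [f] the identity, and the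
  algebras with a faithful *-representation [f]. *)
Lemma cstar_norm_repr X (A : starAlg C) (f : sa_amb A -> op C X) :
    linear f -> {in sa_sub A, forall x, f x = 0 -> x = 0} ->
    {in sa_sub A &, forall x y, f (sa_mul x y) = (f x \o f y)%VF} ->
    {in sa_sub A, forall x, f (sa_star x) = opadj (f x)} ->
    {in sa_sub A, forall x, sa_star x \in sa_sub A} ->
  cstar_norm (A := A) (fun x => opnorm (f x)).
Proof.
move=> fl f0 fM fs sub; split.
- by move=> x _; apply: opnorm_ge0.
- by move=> x xA /opnorm_eq0; apply: f0.
- by move=> c x _; rewrite linZ // opnormZ.
- by move=> x y _ _; rewrite linD // opnormD.
- by move=> x y xA yA; rewrite fM // opnormM.
- by move=> x xA; rewrite fM ?sub // fs // opnorm_cstar.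
Qed.

End OperatorNorm.

Local Open Scope groupoid_scope.

(** * The double groupoid of a match pair *)

Lemma gunit_div (G : finGroupoid) (x y : G) :
  gsrc x = gsrc y -> gunit (x ** ginv y) = (x == y).
Proof.
move=> e; apply/idP/eqP => [u|->]; last by rewrite gmulxV /gunit gsrc_rng.
by rewrite [LHS](ginv_uniq _ u) ?grng_inv // ginvK.
Qed.

Lemma gunit_src (G : finGroupoid) (x : G) : gunit (gsrc x).
Proof. by rewrite /gunit gsrc_src. Qed.

Lemma gunit_rngx (G : finGroupoid) (x : G) : gunit (grng x).
Proof. by rewrite /gunit gsrc_rng. Qed.

Lemma ginv_unit (G : finGroupoid) (x : G) : gunit x -> ginv x = x.
Proof.
by move=> u; apply/esym/ginv_uniq; rewrite ?gunit_mul // (gunit_rng u) (eqP u).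
Qed.

Lemma gunit_inv (G : finGroupoid) (x : G) : gunit (ginv x) = gunit x.
Proof. by apply/idP/idP=> u; [rewrite -[x]ginvK|]; rewrite (ginv_unit u). Qed.

Lemma gdivI (G : finGroupoid) (x y z : G) : gsrc x = gsrc z -> gsrc y = gsrc z ->
  x ** ginv z = y ** ginv z -> x = y.
Proof.
move=> ex ey e; rewrite -[x]gmul_src -[y]gmul_src ex ey -!gmulVx.
by rewrite !gmulA ?grng_inv ?gsrc_inv // e.
Qed.

Lemma gmul_idl (G : finGroupoid) (x y : G) : gsrc x = grng y ->
  (x ** y == y) = gunit x.
Proof.
move=> e; apply/eqP/idP => [E|u]; last exact: gunit_mul.
rewrite -[x]gmul_src e -gmulxV gmulA ?grng_inv // E gmulxV.
exact: gunit_rngx.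
Qed.

Lemma gmul_idr (G : finGroupoid) (x y : G) : gsrc x = grng y ->
  (x ** y == x) = gunit y.
Proof.
move=> e; apply/eqP/idP => [E|u]; last exact: mul_gunit.
rewrite -[y]gmul_rng -e -gmulVx -gmulA ?gsrc_inv // E gmulVx.
exact: gunit_src.
Qed.

Section DoubleGroupoid.
Variables (G : finGroupoid) (H K : {set G}).
Hypothesis mHK : match_pair H K.
Local Notation box := (box H K).
Implicit Types b c d : box.

Lemma memH_mul x y : x \in H -> y \in H -> gsrc x = grng y -> x ** y \in H.
Proof. by case: mHK => [[h _] _ _ _]; apply: h. Qed.
Lemma memH_inv x : x \in H -> ginv x \in H.
Proof. by case: mHK => [[_ h] _ _ _]; apply: h. Qed.
Lemma memK_mul x y : x \in K -> y \in K -> gsrc x = grng y -> x ** y \in K.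
Proof. by case: mHK => [_ [h _] _ _]; apply: h. Qed.
Lemma memK_inv x : x \in K -> ginv x \in K.
Proof. by case: mHK => [_ [_ h] _ _]; apply: h. Qed.
Lemma memH_unit x : gunit x -> x \in H.
Proof. by move=> u; case/andP: (unit_in mHK u). Qed.
Lemma memK_unit x : gunit x -> x \in K.
Proof. by move=> u; case/andP: (unit_in mHK u). Qed.

Lemma topK b : top b \in K. Proof. by case: (boxP b). Qed.
Lemma rightH b : right b \in H. Proof. by case: (boxP b). Qed.
Lemma leftH b : left b \in H. Proof. by case: (bottomP mHK b). Qed.
Lemma bottomK b : bottom b \in K. Proof. by case: (bottomP mHK b). Qed.
Lemma src_top b : gsrc (top b) = grng (right b). Proof. by case: (boxP b). Qed.
Lemma src_left b : gsrc (left b) = grng (bottom b). Proof. by case: (bottomP mHK b). Qed.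
Lemma src_bottom b : gsrc (bottom b) = gsrc (right b). Proof. by case: (bottomP mHK b). Qed.
Lemma rng_left b : grng (left b) = grng (top b). Proof. by case: (bottomP mHK b). Qed.

Lemma box_commutes b : left b ** bottom b = top b ** right b.
Proof. by case: (p_dec mHK (top b ** right b)). Qed.

(** Left and bottom edges are always found this way: any factorization of the
  diagonal of the box through [H] and then [K] is the one. *)
Lemma left_bottom b (l c : G) : l \in H -> c \in K -> gsrc l = grng c ->
  top b ** right b = l ** c -> left b = l /\ bottom b = c.
Proof.
by move=> lH cK e E; rewrite /left /bottom /lact /ract E; apply: p_uniq.
Qed.

Definition mkbox d (q : G * G) : box := insubd d q.

Lemma mkboxP d k h : k \in K -> h \in H -> gsrc k = grng h ->
  top (mkbox d (k, h)) = k /\ right (mkbox d (k, h)) = h.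
Proof.
move=> kK hH e; rewrite /top /right val_insubd /crossed_pair /= kK hH e eqxx.
by split.
Qed.

(** The compositions and quotients below are meaningful for composable boxes;
  the first argument is the default value of [mkbox]. *)
Definition vmul b c : box := mkbox b (vcomp b c).
Definition hmul b c : box := mkbox b (hcomp b c).
(** [hquo b c] is the horizontal composite of [b] with the horizontal inverse
  of [c]. *)
Definition hquo b c : box := mkbox b (top b ** ginv (top c), left c).
Definition vinv_box b : box := mkbox b (vinv b).
Definition hvinv_box b : box := mkbox b (hvinv b).

Lemma val_vmul b c : bottom b = top c -> val (vmul b c) = vcomp b c.
Proof. by move/eqP=> e; rewrite val_insubd vcomp_pair. Qed.
Lemma val_hmul b c : right b = left c -> val (hmul b c) = hcomp b c.
Proof. by move/eqP=> e; rewrite val_insubd hcomp_pair. Qed.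
Lemma val_vinv b : val (vinv_box b) = vinv b.
Proof. by rewrite val_insubd vinv_pair. Qed.
Lemma val_hvinv b : val (hvinv_box b) = hvinv b.
Proof. by rewrite val_insubd hvinv_pair. Qed.

Lemma vmulP b c : bottom b = top c ->
  [/\ top (vmul b c) = top b, right (vmul b c) = right b ** right c,
      left (vmul b c) = left b ** left c & bottom (vmul b c) = bottom c].
Proof.
move=> e; have v := val_vmul e.
have t : top (vmul b c) = top b by rewrite /top v.
have r : right (vmul b c) = right b ** right c by rewrite /right v.
have rr : gsrc (right b) = grng (right c) by rewrite -src_bottom e src_top.
have ll : gsrc (left b) = grng (left c) by rewrite src_left e rng_left.
have [||||l bo] := @left_bottom (vmul b c) (left b ** left c) (bottom c); last by split.
- exact: memH_mul (leftH _) (leftH _) ll.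
- exact: bottomK.
- by rewrite gsrc_mul // src_left.
rewrite t r gmulA ?src_top // -box_commutes -!gmulA ?src_left ?src_bottom //.
  by rewrite e box_commutes.
by rewrite e rng_left.
Qed.

Lemma hmulP b c : right b = left c ->
  [/\ top (hmul b c) = top b ** top c, right (hmul b c) = right c,
      left (hmul b c) = left b & bottom (hmul b c) = bottom b ** bottom c].
Proof.
move=> e; have v := val_hmul e.
have t : top (hmul b c) = top b ** top c by rewrite /top v.
have r : right (hmul b c) = right c by rewrite /right v.
have tt : gsrc (top b) = grng (top c) by rewrite src_top e rng_left.
have bb : gsrc (bottom b) = grng (bottom c) by rewrite src_bottom e src_left.
have [||||l bo] := @left_bottom (hmul b c) (left b) (bottom b ** bottom c); last by split.
- exact: leftH.
- exact: memK_mul (bottomK _) (bottomK _) bb.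
- by rewrite grng_mul // src_left.
rewrite t r gmulA ?src_left // box_commutes -!gmulA ?src_top //.
- by rewrite -box_commutes e.
- by rewrite e src_left.
- by rewrite e rng_left.
Qed.

Lemma hquoP b c : right b = right c ->
  [/\ top (hquo b c) = top b ** ginv (top c), right (hquo b c) = left c,
      left (hquo b c) = left b & bottom (hquo b c) = bottom b ** ginv (bottom c)].
Proof.
move=> e.
have tt : gsrc (top b) = grng (ginv (top c)) by rewrite grng_inv !src_top e.
have bb : gsrc (bottom b) = grng (ginv (bottom c)) by rewrite grng_inv !src_bottom e.
have [|||t r] := @mkboxP b (top b ** ginv (top c)) (left c).
- exact: memK_mul (topK _) (memK_inv (topK _)) tt.
- exact: leftH.
- by rewrite gsrc_mul // gsrc_inv rng_left.
have [||||l bo] := @left_bottom (hquo b c) (left b) (bottom b ** ginv (bottom c));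
  last by split.
- exact: leftH.
- exact: memK_mul (bottomK _) (memK_inv (bottomK _)) bb.
- by rewrite grng_mul // src_left.
rewrite t r gmulA ?src_left // box_commutes -!gmulA ?gsrc_inv ?rng_left //; last first.
- by rewrite grng_inv src_bottom e.
- exact: src_top.
congr (_ ** _).
have -> : left c = top c ** right c ** ginv (bottom c).
  rewrite -box_commutes -gmulA ?src_left ?grng_inv //.
  by rewrite gmulxV -src_left gmul_src.
rewrite -gmulA ?src_top // ?grng_inv ?src_bottom //.
by rewrite gmulKV ?e // grng_mul ?src_top // grng_inv src_bottom.
Qed.

Lemma vinvP b :
  [/\ top (vinv_box b) = bottom b, right (vinv_box b) = ginv (right b),
      left (vinv_box b) = ginv (left b) & bottom (vinv_box b) = top b].
Proof.
have v := val_vinv b.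
have t : top (vinv_box b) = bottom b by rewrite /top v.
have r : right (vinv_box b) = ginv (right b) by rewrite /right v.
have [||||l bo] := @left_bottom (vinv_box b) (ginv (left b)) (top b); last by split.
- exact: memH_inv (leftH _).
- exact: topK.
- by rewrite gsrc_inv rng_left.
rewrite t r; apply: (@gmulI _ (left b)).
- by rewrite grng_mul ?src_left // grng_inv src_bottom.
- by rewrite grng_mul ?grng_inv // gsrc_inv rng_left.
rewrite gmulVK ?rng_left // gmulA ?src_left ?grng_inv ?src_bottom //.
by rewrite box_commutes -gmulA ?src_top ?grng_inv // gmulxV -src_top gmul_src.
Qed.

Lemma hvinvP b :
  [/\ top (hvinv_box b) = ginv (bottom b), right (hvinv_box b) = ginv (left b),
      left (hvinv_box b) = ginv (right b) & bottom (hvinv_box b) = ginv (top b)].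
Proof.
have v := val_hvinv b.
have t : top (hvinv_box b) = ginv (bottom b) by rewrite /top v.
have r : right (hvinv_box b) = ginv (left b) by rewrite /right v.
have [||||l bo] := @left_bottom (hvinv_box b) (ginv (right b)) (ginv (top b));
  last by split.
- exact: memH_inv (rightH _).
- exact: memK_inv (topK _).
- by rewrite gsrc_inv grng_inv src_top.
by rewrite t r -!ginv_mul ?src_left ?src_top // box_commutes.
Qed.

(** With a unit as top edge, the box is a horizontal identity. *)
Lemma gunit_left b : gunit (top b) -> left b = right b /\ bottom b = gsrc (right b).
Proof.
move=> u; apply: left_bottom; rewrite ?rightH ?grng_src //.
  exact: memK_unit (gunit_src _).
by rewrite gunit_mul ?src_top // gmul_src.
Qed.

(** The vertical inverse exchanges the two edges, so one implication is enough. *)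
Lemma gunit_bottom b : gunit (bottom b) = gunit (top b).
Proof.
suff h c : gunit (top c) -> gunit (bottom c).
  apply/idP/idP=> [u|]; last exact: h.
  by have [t _ _ bo] := vinvP b; rewrite -bo h // t.
by move=> u; have [_ ->] := gunit_left u; apply: gunit_src.
Qed.

Lemma gunit_right b : gunit (right b) ->
  [/\ right b = gsrc (top b), left b = grng (top b) & bottom b = top b].
Proof.
move=> u; have r : right b = gsrc (top b) by rewrite src_top gunit_rng.
suff [-> ->] : left b = grng (top b) /\ bottom b = top b by split.
apply: left_bottom; rewrite ?topK ?gsrc_rng //.
  exact: memH_unit (gunit_rngx _).
by rewrite r gmul_src gmul_rng.
Qed.

(** The vertical inverse reduces this to the case of the top and right edges. *)
Lemma bottom_inj b c : bottom b = bottom c -> right b = right c -> b = c.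
Proof.
move=> eb er; have [t r _ _] := vinvP b; have [t' r' _ _] := vinvP c.
have E : vinv_box b = vinv_box c by apply: box_inj; rewrite ?t ?t' ?r ?r' ?eb ?er.
have [_ _ _ b1] := vinvP b; have [_ _ _ b2] := vinvP c.
by apply: box_inj; rewrite // -b1 -b2 E.
Qed.

Lemma vinv_boxK : involutive vinv_box.
Proof.
move=> b; have [t r _ bo] := vinvP b; have [t' r' _ _] := vinvP (vinv_box b).
by apply: box_inj; rewrite ?t' ?bo // r' r ginvK.
Qed.

Lemma hmul_hquo b c d : right b = left c -> right d = right c ->
  (hmul b c == d) = (b == hquo d c).
Proof.
move=> e e'; have [t r l _] := hmulP e; have [t' r' l' _] := hquoP e'.
have s1 : gsrc (top b) = grng (top c) by rewrite src_top e rng_left.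
have s2 : gsrc (top d) = gsrc (top c) by rewrite !src_top e'.
apply/eqP/eqP => E; apply: box_inj; rewrite ?r ?r' ?e ?t ?t' //.
- by rewrite -E t -gmulA ?grng_inv // gmulxV -s1 gmul_src.
- by rewrite E t' -gmulA ?gsrc_inv ?grng_inv // gmulVx -s2 gmul_src.
Qed.

End DoubleGroupoid.

(** * Sums over boxes *)

Section BoxSums.
Variables (G : finGroupoid) (H K : {set G}).
Hypothesis mHK : match_pair H K.
Local Notation box := (box H K).
Implicit Types b c d u v x y : box.

Lemma hquo_hmul b c : right b = left c -> hquo (hmul b c) c = b.
Proof.
move=> e; have [_ r _ _] := hmulP mHK e.
by apply/esym/eqP; rewrite -hmul_hquo // ?r.
Qed.

Lemma hmul_hquoK b c : right b = right c -> hmul (hquo b c) c = b.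
Proof.
move=> e; have [_ r _ _] := hquoP mHK e.
by apply/eqP; rewrite hmul_hquo.
Qed.

Lemma hquo_hquo b c d : right b = right d -> right c = right d ->
  hquo (hquo b d) (hquo c d) = hquo b c.
Proof.
move=> eb ec; have [t r l _] := hquoP mHK eb; have [t' r' l' _] := hquoP mHK ec.
have ebc : right b = right c by rewrite eb.
have [t3 r3 _ _] := hquoP mHK ebc.
have [|t4 r4 _ _] := @hquoP _ _ _ mHK (hquo b d) (hquo c d); first by rewrite r r'.
apply: box_inj; rewrite ?r4 ?r3 ?l' // t4 t3 t t' ginv_mul ?ginvK; last first.
  by rewrite grng_inv !(src_top) ec.
rewrite -gmulA ?gsrc_inv ?grng_inv ?grng_mul ?gsrc_inv ?grng_inv ?src_top ?eb //.
  by rewrite gmulKV // grng_inv !src_top ec.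
by rewrite ec.
Qed.

(** Right division by [c] in the horizontal groupoid is a bijection. *)
Lemma sum_hquo (V : nmodType) c (F : box -> V) :
  \sum_(b | right b == right c) F (hquo b c) = \sum_(u | right u == left c) F u.
Proof.
rewrite (reindex_onto (fun u => hmul u c) (fun b => hquo b c)) /=; last first.
  by move=> b /eqP e; apply: hmul_hquoK.
apply: eq_big => [u|u /andP[_ /eqP-> //]].
apply/andP/eqP=> [[/eqP e1 /eqP e2]|e].
  by have [_ r _ _] := hquoP mHK e1; rewrite -[in LHS]e2 r.
by have [_ r _ _] := hmulP mHK e; rewrite hquo_hmul // r !eqxx.
Qed.

(** The change of variable behind coassociativity: with [u = c / d] one has
  [x / c = (x / d) / u], and [u] ranges over all boxes composable with [d]. *)
Lemma sum_hquo_assoc (V : nmodType) x (F : box -> box -> box -> V) :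
  \sum_(c | right c == right x) \sum_(d | right d == right (hquo x c))
    F (hquo (hquo x c) d) d c
  = \sum_(c | right c == right x) \sum_(d | right d == right c)
    F (hquo x c) (hquo c d) d.
Proof.
transitivity (\sum_(d | right d == right x) \sum_(c | right c == right d)
    F (hquo (hquo x d) (hquo c d)) (hquo c d) d).
  apply: eq_bigr => c /eqP e.
  have [_ -> _ _] := hquoP mHK (esym e).
  by rewrite (sum_hquo _ (fun u => F (hquo (hquo x c) u) u c)).
rewrite [RHS](exchange_big_dep (fun d => right d == right x)) /=; last first.
  by move=> c d /eqP-> ->.
apply: eq_bigr => d /eqP e; apply: eq_big => [c|c /eqP ec].
  by rewrite -e [right d == _]eq_sym andbb.
by rewrite hquo_hquo // e.
Qed.

End BoxSums.

(** * Weak Hopf algebras with a basis of boxes *)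

Section BoxBasis.
Variables (C : numClosedFieldType) (G : finGroupoid) (H K : {set G}).
Hypothesis mHK : match_pair H K.
Local Notation box := (box H K).
Implicit Types b c d u v : box.

(** The structure constants of the double groupoid, carried by a spanning family
  of an arbitrary algebra, so that one verification of the axioms serves for the
  algebra of the boxes and for its image in the operators. *)
Record box_basis (A : whAlg C) (e : box -> sa_amb A) : Prop := {
  bb_span : forall x, x \in sa_sub A -> exists F : box -> C, x = \sum_b F b *: e b;
  bb_sub : forall b, e b \in sa_sub A;
  bb_mul : forall b c,
    sa_mul (e b) (e c) = if bottom b == top c then e (vmul b c) else 0;
  bb_one : sa_one A = \sum_(b | gunit (right b)) e b;
  bb_star : forall b, sa_star (e b) = e (vinv_box b);
  bb_delta : forall b,
    wh_delta (e b) = \sum_(c | right c == right b) tens (e (hquo b c)) (e c);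
  bb_S : forall b, wh_S (e b) = e (hvinv_box b);
  bb_eps : forall b, wh_eps (e b) = (gunit (top b))%:R
}.

Variables (A : whAlg C) (e : box -> sa_amb A).
Hypotheses (bA : box_basis e) (algA : starAlgP A).
Hypotheses (Dl : linear (@wh_delta C A)) (Sl : linear (@wh_S C A))
  (El : scalar (@wh_eps C A)).
Local Notation mul := (@sa_mul C A).
Local Notation D := (@wh_delta C A).
Local Notation S := (@wh_S C A).
Local Notation eps := (@wh_eps C A).
Local Notation one := (sa_one A).

(** All the axioms reduce to boxes by this principle, applied to one variable
  at a time. *)
Lemma span_ext (sigma : C -> C) (V : lmodType C) (f g : sa_amb A -> V) :
    sigma 1 = 1 -> semilinear_over sigma f -> semilinear_over sigma g ->
  (forall b, f (e b) = g (e b)) -> forall x, x \in sa_sub A -> f x = g x.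
Proof.
move=> s1 fl gl fg x /(bb_span bA)[F ->].
rewrite (semilin_sum _ _ _ s1 fl) (semilin_sum _ _ _ s1 gl); apply: eq_bigr => b _.
by rewrite (semilinZ _ _ s1 fl) (semilinZ _ _ s1 gl) fg.
Qed.

Lemma mul_bilin : bilinear_map mul.
Proof.
split=> [b|a] c x y; first exact: (sa_mulDl algA).
exact: (sa_mulDr algA).
Qed.

Let mull y := mul_bilin.1 y.
Let mulr x := mul_bilin.2 x.
Let eps_lin : linear (eps : _ -> C^o) := El.

Lemma tlift_D (V : lmodType C) (f : sa_amb A -> sa_amb A -> V) x :
  bilinear_map f ->
  tlift f (D (e x)) = \sum_(c | right c == right x) f (e (hquo x c)) (e c).
Proof.
move=> fb; rewrite (bb_delta bA) tlift_sum; apply: eq_bigr => c _.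
exact: tlift_tens_bilin.
Qed.

(** The quotients by a vertical identity [v] of the boxes with the same right
  edge are the vertical identities composable with [v], by [sum_hquo]. *)
Lemma delta_one : D one
  = \sum_(v | gunit (right v)) \sum_(u | right u == left v) tens (e u) (e v).
Proof.
rewrite (bb_one bA) (lin_sum _ _ _ Dl).
under eq_bigr do rewrite (bb_delta bA).
rewrite (exchange_big_dep (fun c => gunit (right c))) /=; last first.
  by move=> b c ub /eqP->.
apply: eq_bigr => c uc; rewrite -(sum_hquo mHK c (fun u => tens (e u) (e c))).
by apply: eq_bigl => b; rewrite eq_sym andbC; case: eqP => //= ->.
Qed.

Lemma tlift_D1 (V : lmodType C) (f : sa_amb A -> sa_amb A -> V) :
  bilinear_map f -> tlift f (D one)
  = \sum_(v | gunit (right v)) \sum_(u | right u == left v) f (e u) (e v).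
Proof.
move=> fb; rewrite delta_one tlift_sum; apply: eq_bigr => c _.
by rewrite tlift_sum; apply: eq_bigr => u _; apply: tlift_tens_bilin.
Qed.

Lemma delta_sub x : x \in sa_sub A -> D x \in tensv (sa_sub A).
Proof.
case/(bb_span bA)=> F ->; rewrite (lin_sum _ _ _ Dl) memv_suml // => b _.
rewrite (linZ _ _ Dl) memvZ // (bb_delta bA) memv_suml // => c _.
by rewrite mem_tensv ?(bb_sub bA).
Qed.

Lemma S_sub x : x \in sa_sub A -> S x \in sa_sub A.
Proof.
case/(bb_span bA)=> F ->; rewrite (lin_sum _ _ _ Sl) memv_suml // => b _.
by rewrite (linZ _ _ Sl) memvZ // (bb_S bA) (bb_sub bA).
Qed.

Lemma box_coassoc x : x \in sa_sub A ->
  tmap D id (D x) = tassoc (tmap id D (D x)).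
Proof.
move: x; apply: (@span_ext id) => // [||b].
- exact: lin_comp (tmap_lin _ _) Dl.
- exact: lin_comp (@tassoc_lin _ _ _ _) (lin_comp (tmap_lin _ _) Dl).
rewrite (bb_delta bA) !(lin_sum _ _ _ (tmap_lin _ _)) (lin_sum _ _ _ (@tassoc_lin _ _ _ _)).
transitivity (\sum_(c | right c == right b)
    \sum_(d | right d == right (hquo b c))
       tens (tens (e (hquo (hquo b c) d)) (e d)) (e c)).
  apply: eq_bigr => c _; rewrite tmap_tens // (bb_delta bA).
  by rewrite (lin_sum _ _ _ ((tens_bilin _ _).1 _)).
rewrite (sum_hquo_assoc mHK b (fun x y z => tens (tens (e x) (e y)) (e z))).
apply: eq_bigr => c _; rewrite tmap_tens // (bb_delta bA).
rewrite (lin_sum _ _ _ ((tens_bilin _ _).2 _)) (lin_sum _ _ _ (@tassoc_lin _ _ _ _)).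
by apply: eq_bigr => d _; rewrite tassoc_tens.
Qed.

Lemma eps_scalel_bilin : bilinear_map (fun s t : sa_amb A => eps s *: t).
Proof.
split=> [b|a] c x y; first by rewrite El scalerDl scalerA.
by rewrite scalerDr !scalerA mulrC.
Qed.

Lemma eps_scaler_bilin : bilinear_map (fun s t : sa_amb A => eps t *: s).
Proof.
split=> [b|a] c x y; first by rewrite scalerDr !scalerA mulrC.
by rewrite El scalerDl scalerA.
Qed.

(** A horizontal quotient has a unit as top edge only when it is trivial; the
  counit thus keeps a single term of the coproduct. *)
Lemma gunit_top_hquo x c : right c = right x ->
  gunit (top (hquo x c)) = (c == x).
Proof.
move=> er; have [-> _ _ _] := hquoP mHK (esym er).
rewrite gunit_div ?src_top ?er //.
by apply/eqP/eqP => [et|->] //; apply: box_inj.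
Qed.

Lemma box_counitl x : x \in sa_sub A -> tlift (fun s t => eps s *: t) (D x) = x.
Proof.
move: x; apply: (@span_ext id) => // [|b].
  exact: lin_comp (tlift_lin _) Dl.
rewrite tlift_D; last exact: eps_scalel_bilin.
rewrite (bigD1 b) //= (bb_eps bA) gunit_top_hquo // eqxx scale1r.
rewrite big1 ?addr0 // => c /andP[/eqP er nc].
by rewrite (bb_eps bA) gunit_top_hquo // (negPf nc) scale0r.
Qed.

(** The horizontal identity of the right edge. *)
Definition hunit x : box := mkbox x (grng (right x), right x).

Lemma hunitP x : top (hunit x) = grng (right x) /\ right (hunit x) = right x.
Proof.
apply: mkboxP; rewrite ?rightH ?gsrc_rng //.
exact: (memK_unit mHK) (gunit_rngx _).
Qed.

Lemma gunit_top_hunit x c : right c = right x -> gunit (top c) = (c == hunit x).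
Proof.
have [t r] := hunitP x => er; apply/idP/eqP=> [u|->]; last by rewrite t gunit_rngx.
by apply: box_inj; rewrite ?r // t -er -src_top (eqP u).
Qed.

Lemma hquo_hunit x : hquo x (hunit x) = x.
Proof.
have [t r] := hunitP x; have [t' r' _ _] := hquoP mHK (esym r).
have [lh _] := gunit_left mHK (etrans (gunit_top_hunit r) (eqxx _)).
apply: box_inj; rewrite ?r' ?lh // t' t ginv_unit ?gunit_rngx //.
by rewrite -src_top gmul_src.
Qed.

Lemma box_counitr x : x \in sa_sub A -> tlift (fun s t => eps t *: s) (D x) = x.
Proof.
move: x; apply: (@span_ext id) => // [|b].
  exact: lin_comp (tlift_lin _) Dl.
rewrite tlift_D; last exact: eps_scaler_bilin.
have [_ r] := hunitP b.
rewrite (bigD1 (hunit b)) /= ?r // (bb_eps bA) (gunit_top_hunit r) eqxx scale1r.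
rewrite hquo_hunit big1 ?addr0 // => c /andP[/eqP er nc].
by rewrite (bb_eps bA) (gunit_top_hunit er) (negPf nc) scale0r.
Qed.

Lemma box_delta_star x : x \in sa_sub A ->
  D (sa_star x) = tconj_map (@sa_star C A) (@sa_star C A) (D x).
Proof.
have starl : semilinear_over (fun c : C => c^*) (@sa_star C A).
  by move=> c u v; apply: (sa_starD algA).
have c1 := rmorph1 (@Num.conj C).
move: x; apply: (@span_ext (fun c : C => c^*)) => // [c u v|c u v|b].
- by rewrite (sa_starD algA) Dl.
- by rewrite Dl tconj_map_semilin.
rewrite (bb_star bA) !(bb_delta bA) (semilin_sum _ _ _ c1 (tconj_map_semilin _ _)).
rewrite (reindex_inj (inv_inj (vinv_boxK mHK))) /=.
have [tb rb lb bb] := vinvP mHK b.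
apply: eq_big => [c|c].
  have [_ rc _ _] := vinvP mHK c.
  by rewrite rc rb (inj_eq (can_inj (@ginvK G))).
have [tc rc lc bc] := vinvP mHK c.
rewrite rc rb (inj_eq (can_inj (@ginvK G))) => /eqP er.
rewrite tconj_map_tens // !(bb_star bA); congr (tens (e _) _).
have [t r l bo] := hquoP mHK (esym er).
have [t' r' _ _] := vinvP mHK (hquo b c).
have [|t2 r2 _ _] := @hquoP _ _ _ mHK (vinv_box b) (vinv_box c).
  by rewrite rb rc er.
by apply: box_inj; rewrite ?t2 ?t' ?r2 ?r' ?bo ?tb ?tc ?r ?lc.
Qed.


(** The interchange law of the double groupoid, for horizontal quotients. *)
Lemma vmul_hquo b c b' c' : bottom b = top c -> bottom b' = top c' ->
    right b = right b' -> right c = right c' ->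
  vmul (hquo b b') (hquo c c') = hquo (vmul b c) (vmul b' c').
Proof.
move=> E E' er er'.
have [t1 r1 l1 b1] := hquoP mHK er; have [t2 r2 l2 b2] := hquoP mHK er'.
have [t3 r3 l3 b3] := vmulP mHK E; have [t4 r4 l4 b4] := vmulP mHK E'.
have [|t5 r5 _ _] := @vmulP _ _ _ mHK (hquo b b') (hquo c c').
  by rewrite b1 t2 E E'.
have [|t6 r6 _ _] := @hquoP _ _ _ mHK (vmul b c) (vmul b' c').
  by rewrite r3 r4 er er'.
by apply: box_inj; rewrite ?t5 ?t6 ?r5 ?r6 ?t1 ?t3 ?t4 ?r1 ?r2.
Qed.

Lemma tens0l (x : sa_amb A) : tens (0 : sa_amb A) x = 0.
Proof. exact: lin0 ((tens_bilin _ _).1 _). Qed.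

Lemma tens0r (x : sa_amb A) : tens x (0 : sa_amb A) = 0.
Proof. exact: lin0 ((tens_bilin _ _).2 _). Qed.

(** Let [b] and [c] be vertically composable.  Given a right factor [b'] of [b],
  the only right factor of [c] composable with it is the box [cor b'] with top
  edge [bottom b'] and right edge [right c], and [b' |-> vmul b' (cor b')] is a
  bijection onto the right factors of [vmul b c].  If [b] and [c] are not
  composable, neither are their factors, as their bottom and top edges could be
  multiplied. *)
Lemma box_delta_mul_basis b c :
  D (mul (e b) (e c)) = tmul mul mul (D (e b)) (D (e c)).
Proof.
have tb := tmul_bilin mul mul; have mb := mul_bilin.
rewrite [in RHS](bb_delta bA) (lin_sum _ _ _ (tb.1 _)).
under [RHS]eq_bigr => b' _.
  rewrite (bb_delta bA) (lin_sum _ _ _ (tb.2 _)).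
  under eq_bigr => c' _ do rewrite tmul_tens // !(bb_mul bA).
  over.
rewrite (bb_mul bA); case: eqP => [E|nE]; last first.
  rewrite (lin0 Dl) big1 // => b' /eqP er; rewrite big1 // => c' /eqP er'.
  case: (bottom b' =P top c') => [e'|_]; last exact: tens0r.
  case: eqP => [E|_]; last exact: tens0l.
  have [_ _ _ b1] := hquoP mHK (esym er); have [t2 _ _ _] := hquoP mHK (esym er').
  case: nE; move: E; rewrite b1 t2 e'; apply: gdivI.
    by rewrite src_bottom // -er -src_bottom // e'.
  by rewrite !src_top er'.
have [t0 r0 _ _] := vmulP mHK E.
have sbc : gsrc (right b) = grng (right c) by rewrite -src_bottom // E src_top.
rewrite (bb_delta bA).
pose cor b' := mkbox b' (bottom b', right c).
have corP b' : right b' = right b -> top (cor b') = bottom b' /\ right (cor b') = right c.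
  move=> er; apply: mkboxP; rewrite ?bottomK ?rightH //.
  by rewrite src_bottom // er.
have topP d : right d = right (vmul b c) ->
    top (mkbox d (top d, right b)) = top d /\ right (mkbox d (top d, right b)) = right b.
  move=> er; apply: mkboxP; rewrite ?topK ?rightH //.
  by rewrite src_top er r0 grng_mul.
rewrite (reindex_onto (fun b' => vmul b' (cor b'))
   (fun d => mkbox d (top d, right b))) /=; last first.
  move=> d /eqP er; have [t1 r1] := topP d er; have [t2 r2] := corP _ r1.
  have [t3 r3 _ _] := vmulP mHK (esym t2).
  by apply: box_inj; rewrite ?t3 ?t1 // r3 r2 r1 er.
apply: eq_big => [b'|b' /andP[/eqP er /eqP er2]].
  apply/andP/eqP=> [[/eqP er /eqP er2]|er].
    by have [_ r1] := topP _ er; rewrite -er2.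
  have [t2 r2] := corP _ er; have [t3 r3 _ _] := vmulP mHK (esym t2).
  have er3 : right (vmul b' (cor b')) = right (vmul b c) by rewrite r3 r2 er.
  have [t4 r4] := topP _ er3.
  by split; apply/eqP=> //; apply: box_inj; rewrite ?t4 ?r4.
have erb : right b' = right b by have [_ r1] := topP _ er; rewrite -er2.
have [t2 r2] := corP _ erb.
have [_ _ _ b1] := hquoP mHK (esym erb); have [t4 _ _ _] := hquoP mHK (esym r2).
rewrite (bigD1 (cor b')) /= ?r2 // t2 eqxx b1 t4 t2 E eqxx vmul_hquo //.
rewrite big1 ?addr0 // => c' /andP[/eqP er' nc].
case: (bottom b' =P top c') => [e'|_]; last exact: tens0r.
by case/eqP: nc; apply: box_inj; rewrite ?t2 ?r2.
Qed.

Lemma box_delta_mul x y : x \in sa_sub A -> y \in sa_sub A ->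
  D (mul x y) = tmul mul mul (D x) (D y).
Proof.
move=> xA yA; have tb := tmul_bilin mul mul.
move: x xA; apply: (@span_ext id) => // [||b].
- exact: lin_comp Dl (mull y).
- exact: lin_comp (tb.1 _) Dl.
move: y yA; apply: (@span_ext id) => // [||c].
- exact: lin_comp Dl (mulr _).
- exact: lin_comp (tb.2 _) Dl.
exact: box_delta_mul_basis.
Qed.

Lemma mul_vunit b c : gunit (right b) -> gunit (right c) ->
  mul (e b) (e c) = if b == c then e b else 0.
Proof.
move=> ub uc; have [rb _ bb] := gunit_right mHK ub; have [rc _ _] := gunit_right mHK uc.
rewrite (bb_mul bA) bb; have [ebc|nbc] := eqVneq b c.
  rewrite -ebc eqxx; congr e; have [t r _ _] := vmulP mHK bb.
  by apply: box_inj; rewrite ?t ?r // gunit_mul // (gunit_rng ub) (eqP ub).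
case: eqP => // et; case/eqP: nbc; apply: box_inj => //.
by rewrite rb rc et.
Qed.

Lemma vunit_left b : gunit (right b) -> gunit (left b).
Proof. by case/(gunit_right mHK)=> _ -> _; apply: gunit_rngx. Qed.

Lemma delta2_one : tmap D id (D one)
  = \sum_(v | gunit (right v)) \sum_(w | right w == left v)
      \sum_(t | right t == left w) tens (tens (e t) (e w)) (e v).
Proof.
have [tl tr] := tens_bilin (tensor (sa_amb A) (sa_amb A)) (sa_amb A).
rewrite delta_one (lin_sum _ _ _ (tmap_lin _ _)); apply: eq_bigr => v _.
rewrite (lin_sum _ _ _ (tmap_lin _ _)).
under eq_bigr => u _ do
  rewrite tmap_tens // (bb_delta bA) (lin_sum _ _ _ (tl _)).
rewrite (exchange_big_dep (fun w => right w == left v)) /=; last first.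
  by move=> u w /eqP-> ->.
apply: eq_bigr => w /eqP ew.
rewrite -(sum_hquo mHK w (fun t => tens (tens (e t) (e w)) (e v))).
by apply: eq_bigl => u; rewrite ew [left v == _]eq_sym andbb.
Qed.

Lemma delta_one_l : tens (D one) one
  = \sum_(w | gunit (right w)) \sum_(t | right t == left w)
      tens (tens (e t) (e w)) one.
Proof.
have [tl _] := tens_bilin (tensor (sa_amb A) (sa_amb A)) (sa_amb A).
rewrite delta_one (lin_sum _ _ _ (tl _)); apply: eq_bigr => w _.
by rewrite (lin_sum _ _ _ (tl _)).
Qed.

Lemma delta_one_r : tassoc (tens one (D one))
  = \sum_(v | gunit (right v)) \sum_(w | right w == left v)
      tens (tens one (e w)) (e v).
Proof.
have [_ tr] := tens_bilin (sa_amb A) (tensor (sa_amb A) (sa_amb A)).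
rewrite delta_one (lin_sum _ _ _ (tr _)) (lin_sum _ _ _ (@tassoc_lin _ _ _ _)).
apply: eq_bigr => v _.
rewrite (lin_sum _ _ _ (tr _)) (lin_sum _ _ _ (@tassoc_lin _ _ _ _)).
by apply: eq_bigr => w _; rewrite tassoc_tens.
Qed.

(** The products of distinct vertical identities vanish, so the middle factors
  of the two copies of the coproduct of the unit must agree. *)
Lemma vunit_collapse (V : nmodType) w (F : box -> sa_amb A -> V) :
    (forall t, F t 0 = 0) -> gunit (right w) ->
  \sum_(w' | gunit (right w')) \sum_(t | right t == left w')
     F t (if w' == w then e w else 0)
  = \sum_(t | right t == left w) F t (e w).
Proof.
move=> F0 uw; rewrite (bigD1 w) //= eqxx [X in _ + X]big1 ?addr0 //.
by move=> w' /andP[_ /negPf->]; rewrite big1.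
Qed.

Lemma box_delta_one1 : tmap D id (D one)
  = tmul (tmul mul mul) mul (tens (D one) one) (tassoc (tens one (D one))).
Proof.
have mb := mul_bilin; have tb := tmul_bilin mul mul.
have [tl tr] := tmul_bilin (tmul mul mul) mul.
have [t2l _] := tens_bilin (tensor (sa_amb A) (sa_amb A)) (sa_amb A).
rewrite delta2_one delta_one_r (lin_sum _ _ _ (tr _)); apply: eq_bigr => v uv.
rewrite (lin_sum _ _ _ (tr _)); apply: eq_bigr => w /eqP ew.
have uw : gunit (right w) by rewrite ew vunit_left.
rewrite delta_one_l (lin_sum _ _ _ (tl _)).
rewrite -(@vunit_collapse _ w (fun t x => tens (tens (e t) x) (e v))) //; last first.
  by move=> t; rewrite tens0r (lin0 (t2l _)).
apply: eq_bigr => w' uw'; rewrite (lin_sum _ _ _ (tl _)); apply: eq_bigr => t _.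
rewrite !tmul_tens // (sa_mul1r algA) (sa_mul1l algA) mul_vunit //.
by case: eqP => // ->.
Qed.

Lemma box_delta_one2 : tmap D id (D one)
  = tmul (tmul mul mul) mul (tassoc (tens one (D one))) (tens (D one) one).
Proof.
have mb := mul_bilin; have tb := tmul_bilin mul mul.
have [tl tr] := tmul_bilin (tmul mul mul) mul.
have [t2l _] := tens_bilin (tensor (sa_amb A) (sa_amb A)) (sa_amb A).
rewrite delta2_one delta_one_r (lin_sum _ _ _ (tl _)); apply: eq_bigr => v uv.
rewrite (lin_sum _ _ _ (tl _)); apply: eq_bigr => w /eqP ew.
have uw : gunit (right w) by rewrite ew vunit_left.
rewrite delta_one_l (lin_sum _ _ _ (tr _)).
rewrite -(@vunit_collapse _ w (fun t x => tens (tens (e t) x) (e v))) //; last first.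
  by move=> t; rewrite tens0r (lin0 (t2l _)).
apply: eq_bigr => w' uw'; rewrite (lin_sum _ _ _ (tr _)); apply: eq_bigr => t _.
by rewrite !tmul_tens // (sa_mul1r algA) (sa_mul1l algA) mul_vunit // eq_sym.
Qed.

Lemma eps_mul_box b c :
  eps (mul (e b) (e c)) = ((bottom b == top c) && gunit (top b))%:R.
Proof.
rewrite (bb_mul bA); case: eqP => [E|_]; last exact: lin0 eps_lin.
by rewrite (bb_eps bA); have [-> _ _ _] := vmulP mHK E.
Qed.

Lemma eps_mul3_box b c d : eps (mul (mul (e b) (e c)) (e d))
  = [&& bottom b == top c, bottom c == top d & gunit (top b)]%:R.
Proof.
rewrite (bb_mul bA); case: eqP => [E|_]; last first.
  by rewrite (lin0 (mull _)) (lin0 eps_lin).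
by rewrite eps_mul_box; have [-> _ _ ->] := vmulP mHK E.
Qed.

Let eps_mulr_l x k : linear (fun s => eps (mul x s) * k : C^o).
Proof. by move=> c u v; rewrite mulr El mulrDl -mulrA. Qed.

Let eps_mull_r x k : linear (fun s => k * eps (mul s x) : C^o).
Proof. by move=> c u v; rewrite mull El mulrDr mulrCA. Qed.

Let eps_mull_l x k : linear (fun s => eps (mul s x) * k : C^o).
Proof. by move=> c u v; rewrite mull El mulrDl -mulrA. Qed.

Let eps_mulr_r x k : linear (fun s => k * eps (mul x s) : C^o).
Proof. by move=> c u v; rewrite mulr El mulrDr mulrCA. Qed.

(** Both sides test that three boxes are vertically composable and have unit
  top edges: the counits force the factorization of the middle box to be the
  trivial one, whose right factor is a horizontal identity. *)
Lemma box_eps_mul1 x y z : x \in sa_sub A -> y \in sa_sub A -> z \in sa_sub A ->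
  eps (mul (mul x y) z)
  = tlift (fun s t => eps (mul x s) * eps (mul t z) : C^o) (D y).
Proof.
move=> xA yA zA.
move: x xA; apply: (@span_ext id _ (fun x => _ : C^o)) => // [||b].
- exact: lin_comp eps_lin (lin_comp (mull z) (mull y)).
- by apply: tlift_param => s t; apply: eps_mull_l.
move: z zA; apply: (@span_ext id _ (fun x => _ : C^o)) => // [||d].
- exact: lin_comp eps_lin (mulr _).
- by apply: tlift_param => s t; apply: eps_mulr_r.
move: y yA; apply: (@span_ext id _ (fun x => _ : C^o)) => // [||c].
- exact: lin_comp eps_lin (lin_comp (mull _) (mulr _)).
- exact: lin_comp (tlift_lin _) Dl.
rewrite tlift_D; last by split=> [t|s]; [apply: eps_mulr_l|apply: eps_mull_r].
have [th rh] := hunitP c; have uh : gunit (top (hunit c)) by rewrite th gunit_rngx.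
rewrite (bigD1 (hunit c)) /= ?rh // big1 ?addr0; last first.
  move=> c' /andP[/eqP er2 nc]; rewrite [X in _ * X]eps_mul_box.
  by rewrite (gunit_top_hunit er2) (negPf nc) andbF mulr0.
rewrite hquo_hunit eps_mul3_box !eps_mul_box uh andbT -natrM mulnb.
have [_ ->] := gunit_left mHK uh; rewrite rh.
case: eqP => //= E; rewrite andbC; case: (boolP (gunit (top b))) => //= ub.
have uc : gunit (top c) by rewrite -E gunit_bottom.
by have [_ ->] := gunit_left mHK uc.
Qed.

Lemma box_eps_mul2 x y z : x \in sa_sub A -> y \in sa_sub A -> z \in sa_sub A ->
  eps (mul (mul x y) z)
  = tlift (fun s t => eps (mul x t) * eps (mul s z) : C^o) (D y).
Proof.
move=> xA yA zA.
move: x xA; apply: (@span_ext id _ (fun x => _ : C^o)) => // [||b].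
- exact: lin_comp eps_lin (lin_comp (mull z) (mull y)).
- by apply: tlift_param => s t; apply: eps_mull_l.
move: z zA; apply: (@span_ext id _ (fun x => _ : C^o)) => // [||d].
- exact: lin_comp eps_lin (mulr _).
- by apply: tlift_param => s t; apply: eps_mulr_r.
move: y yA; apply: (@span_ext id _ (fun x => _ : C^o)) => // [||c].
- exact: lin_comp eps_lin (lin_comp (mull _) (mulr _)).
- exact: lin_comp (tlift_lin _) Dl.
rewrite tlift_D; last by split=> [t|s]; [apply: eps_mull_r|apply: eps_mulr_l].
rewrite (bigD1 c) //= big1 ?addr0; last first.
  move=> c' /andP[/eqP er2 nc]; rewrite [X in _ * X]eps_mul_box.
  by rewrite gunit_top_hquo // (negPf nc) andbF mulr0.
rewrite eps_mul3_box !eps_mul_box gunit_top_hquo // eqxx andbT -natrM mulnb.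
have [_ _ _ ->] := hquoP mHK (erefl (right c)); rewrite gmulxV.
case: eqP => //= E; rewrite andbC; case: (boolP (gunit (top b))) => //= ub.
by rewrite gunit_rng // gunit_bottom // -E gunit_bottom.
Qed.

Lemma right_mkbox b k h : right b = h -> right (mkbox b (k, h)) = h.
Proof.
by move=> r; rewrite {1}/right val_insubd; case: ifP => // _; rewrite -/(right b).
Qed.

(** For a box [b], the left factor [b / c] is composable with the antipode of [c] only if the
  bottom edge of [b] is a unit, that is if [b] is a horizontal identity; the
  products are then the vertical identities [v] with left edge [top b], each
  obtained once. *)
Lemma box_antipode_t x : x \in sa_sub A ->
  tlift (fun s t => mul s (S t)) (D x)
  = tlift (fun s t => eps (mul s x) *: t) (D one).
Proof.
move: x; apply: (@span_ext id) => // [||b].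
- exact: lin_comp (tlift_lin _) Dl.
- apply: tlift_param => s t k u v.
  by rewrite mulr El scalerDl scalerA.
rewrite tlift_D; last by split=> [t|s]; [apply: mull|exact: lin_comp (mulr _) Sl].
rewrite tlift_D1; last first.
  split=> [t|s] k u v; first by rewrite mull El scalerDl scalerA.
  by rewrite scalerDr !scalerA mulrC.
under [LHS]eq_bigr => c /eqP er.
  rewrite (bb_S bA) (bb_mul bA).
  have [_ _ _ ->] := hquoP mHK (esym er); have [-> _ _ _] := hvinvP mHK c.
  rewrite gmul_idl; last by rewrite grng_inv !src_bottom // er.
  rewrite gunit_bottom //.
  over.
under [RHS]eq_bigr => v uv.
  under eq_bigr => u /eqP er.
    rewrite eps_mul_box.
    have uu : gunit (right u) by rewrite er vunit_left.
    have [_ _ ->] := gunit_right mHK uu.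
    over.
  over.
case: (boolP (gunit (top b))) => ub; last first.
  rewrite !big1 // => v _; rewrite big1 // => u _.
  by case: eqP => [->|]; rewrite ?(negPf ub) scale0r.
have [lb bb] := gunit_left mHK ub.
transitivity (\sum_(v | gunit (right v) && (left v == top b)) e v); last first.
  (* Only the vertical identity of [top b] composes with [b]. *)
  rewrite big_mkcondr; apply: eq_bigr => v uv; case: eqP => [lv|nl]; last first.
    rewrite big1 // => u /eqP ru; case: eqP => [tu|_]; last by rewrite scale0r.
    case: nl; rewrite -ru; have uu : gunit (right u) by rewrite ru vunit_left.
    by have [-> _ _] := gunit_right mHK uu; rewrite tu (eqP ub).
  have [|||tw rw] := @mkboxP _ H K b (top b) (top b).
  - exact: topK.
  - exact: (memH_unit mHK).
  - by rewrite (gunit_rng ub) (eqP ub).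
  rewrite (bigD1 (mkbox b (top b, top b))) /= ?rw ?lv // tw eqxx ub scale1r.
  rewrite big1 ?addr0 // => u /andP[/eqP ru nu].
  case: eqP => [tu|_]; last by rewrite scale0r.
  by case/eqP: nu; apply: box_inj; rewrite ?tw ?rw.
have sb : top b = grng (right b) by rewrite -src_top (eqP ub).
(* The identity [v] comes from the box with top edge [ginv (top v)]. *)
rewrite [RHS](reindex_onto (fun c => vmul (hquo b c) (hvinv_box c))
  (fun v => mkbox b (ginv (top v), right b))) /=.
  apply: eq_bigl => c; apply/eqP/andP => [er|[_ /eqP <-]]; last exact: right_mkbox.
  have [t1 r1 l1 b1] := hquoP mHK (esym er); have [t2 r2 l2 b2] := hvinvP mHK c.
  have [|t3 r3 l3 b3] := @vmulP _ _ _ mHK (hquo b c) (hvinv_box c).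
    by rewrite b1 t2 gunit_mul ?gunit_bottom // grng_inv !src_bottom // er.
  have tt : top (vmul (hquo b c) (hvinv_box c)) = ginv (top c).
    by rewrite t3 t1 gunit_mul // grng_inv !src_top er.
  split.
    rewrite r3 r1 r2 l3 l1 l2 gmulxV gunit_rngx /= lb er gmulxV.
    by rewrite sb.
  apply/eqP; rewrite tt ginvK; have [|||t4 r4] := @mkboxP _ H K b (top c) (right b).
  - exact: topK.
  - exact: rightH.
  - by rewrite src_top er.
  by apply: box_inj; rewrite ?t4 ?r4.
move=> v /andP[uv /eqP lv].
have [rv lv' bv] := gunit_right mHK uv.
have [|||t4 r4] := @mkboxP _ H K b (ginv (top v)) (right b).
- exact: (memK_inv mHK) (topK _).
- exact: rightH.
- by rewrite gsrc_inv -lv' lv.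
set c := mkbox _ _ in t4 r4 *.
have [t1 r1 l1 b1] := hquoP mHK (esym r4); have [t2 r2 l2 b2] := hvinvP mHK c.
have [|t3 r3 l3 b3] := @vmulP _ _ _ mHK (hquo b c) (hvinv_box c).
  by rewrite b1 t2 gunit_mul ?gunit_bottom // grng_inv !src_bottom // r4.
apply: box_inj.
  by rewrite t3 t1 t4 ginvK gunit_mul // -lv' lv (eqP ub).
by rewrite r3 r1 r2 gmulxV rng_left // t4 grng_inv rv.
Qed.

(** The antipode of [b / c] is composable with [c] only if the top edge of [b]
  is a unit; the product is then the vertical identity of the bottom edge of
  [c]. *)
Lemma antipode_s_box b :
  \sum_(c | right c == right b) mul (S (e (hquo b c))) (e c)
  = if gunit (top b) then \sum_(u | right u == gsrc (right b)) e u else 0.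
Proof.
under eq_bigr => c /eqP er.
  rewrite (bb_S bA) (bb_mul bA).
  have [_ _ _ ->] := hvinvP mHK (hquo b c); have [-> _ _ _] := hquoP mHK (esym er).
  rewrite ginv_mul ?ginvK; last by rewrite grng_inv !src_top er.
  rewrite gmul_idr ?gunit_inv; last by rewrite grng_inv !src_top er.
  over.
case: (boolP (gunit (top b))) => ub; last by rewrite big1.
have [lb bb] := gunit_left mHK ub.
have [tV rV _ _] := vinvP mHK b.
(* The identity [u] comes from the box with bottom edge [top u]. *)
rewrite [RHS](reindex_onto (fun c => vmul (hvinv_box (hquo b c)) c)
  (fun u => vinv_box (mkbox (vinv_box b) (top u, ginv (right b))))) /=.
  apply: eq_bigl => c; apply/eqP/andP => [er|[_ /eqP <-]]; last first.
    have [_ -> _ _] := vinvP mHK (mkbox (vinv_box b)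
      (top (vmul (hvinv_box (hquo b c)) c), ginv (right b))).
    by rewrite right_mkbox ?ginvK.
  have [t1 r1 l1 b1] := hquoP mHK (esym er).
  have [t2 r2 l2 b2] := hvinvP mHK (hquo b c).
  have [|t3 r3 l3 b3] := @vmulP _ _ _ mHK (hvinv_box (hquo b c)) c.
    rewrite b2 t1 ginv_mul ?ginvK; last by rewrite grng_inv !src_top er.
    by rewrite mul_gunit ?gunit_inv // grng_inv !src_top er.
  have tt : top (vmul (hvinv_box (hquo b c)) c) = bottom c.
    rewrite t3 t2 b1 ginv_mul ?ginvK; last by rewrite grng_inv !src_bottom // er.
    by rewrite mul_gunit ?gunit_inv ?gunit_bottom // grng_inv !src_bottom // er.
  split; first by rewrite r3 r2 l1 lb er gmulVx.
  apply/eqP; rewrite tt.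
  have [|||t4 r4] := @mkboxP _ H K (vinv_box b) (bottom c) (ginv (right b)).
  - exact: bottomK.
  - exact: (memH_inv mHK) (rightH _).
  - by rewrite src_bottom // er grng_inv.
  have [t5 r5 l5 b5] := vinvP mHK (mkbox (vinv_box b) (bottom c, ginv (right b))).
  by apply: (bottom_inj mHK); rewrite ?b5 ?r5 ?t4 ?r4 ?ginvK.
move=> u /eqP ru.
have [|||t4 r4] := @mkboxP _ H K (vinv_box b) (top u) (ginv (right b)).
- exact: topK.
- exact: (memH_inv mHK) (rightH _).
- by rewrite src_top ru grng_inv grng_src.
set d := mkbox _ _ in t4 r4 *.
have [t5 r5 l5 b5] := vinvP mHK d.
have er : right (vinv_box d) = right b by rewrite r5 r4 ginvK.
have [t1 r1 l1 b1] := hquoP mHK (esym er).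
have [t2 r2 l2 b2] := hvinvP mHK (hquo b (vinv_box d)).
have [|t3 r3 l3 b3] := @vmulP _ _ _ mHK (hvinv_box (hquo b (vinv_box d))) (vinv_box d).
  rewrite b2 t1 ginv_mul ?ginvK; last by rewrite grng_inv !src_top er.
  by rewrite mul_gunit ?gunit_inv // grng_inv !src_top er.
apply: box_inj.
  rewrite t3 t2 b1 b5 t4 ginv_mul ?ginvK; last first.
    by rewrite grng_inv src_bottom // src_top ru grng_src.
  rewrite mul_gunit ?gunit_inv ?gunit_bottom //.
  by rewrite grng_inv src_bottom // src_top ru grng_src.
by rewrite r3 r2 l1 lb er gmulVx.
Qed.

Lemma box_antipode_s x : x \in sa_sub A ->
  tlift (fun s t => mul (S s) t) (D x)
  = tlift (fun s t => eps (mul x t) *: s) (D one).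
Proof.
move: x; apply: (@span_ext id) => // [||b].
- exact: lin_comp (tlift_lin _) Dl.
- apply: tlift_param => s t k u v.
  by rewrite mull El scalerDl scalerA.
rewrite tlift_D; last by split=> [t|s]; [exact: lin_comp (mull _) Sl|apply: mulr].
rewrite antipode_s_box tlift_D1; last first.
  split=> [t|s] k u v; last by rewrite mulr El scalerDl scalerA.
  by rewrite scalerDr !scalerA mulrC.
under [RHS]eq_bigr => v uv.
  under eq_bigr => u _ do rewrite eps_mul_box.
  over.
case: (boolP (gunit (top b))) => ub; last first.
  by rewrite big1 // => v _; rewrite big1 // => u _; rewrite andbF scale0r.
have [lb bb] := gunit_left mHK ub.
have ubb : gunit (bottom b) by rewrite gunit_bottom.
have [|||tw rw] := @mkboxP _ H K b (bottom b) (bottom b).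
- exact: bottomK.
- exact: (memH_unit mHK).
- by rewrite (gunit_rng ubb) (eqP ubb).
set w := mkbox _ _ in tw rw; have uw : gunit (right w) by rewrite rw.
have [_ lw _] := gunit_right mHK uw.
rewrite [RHS](bigD1 w) //= [X in _ + X]big1 ?addr0; last first.
  move=> v /andP[uv nv]; rewrite big1 // => u _.
  case: eqP => [tv|_]; last by rewrite scale0r.
  case/eqP: nv; apply: box_inj; rewrite ?tw //.
  by have [-> _ _] := gunit_right mHK uv; rewrite -tv rw (eqP ubb).
apply: eq_big => [u|u _]; last by rewrite tw eqxx scale1r.
by rewrite lw tw gunit_rng // bb.
Qed.

(** By [antipode_s_box] only the trivial factorization of a box [b] contributes, and
  among the vertical identities that it leaves exactly one is composable with
  the antipode of [b]. *)
Lemma box_antipode x : x \in sa_sub A ->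
  tlift (fun r t => tlift (fun s s' => mul (mul (S s) s') (S t)) r)
    (tmap D id (D x)) = S x.
Proof.
have fb t : bilinear_map (fun s s' => mul (mul (S s) s') (S t)).
  split=> [s'|s]; first exact: lin_comp (mull _) (lin_comp (mull _) Sl).
  exact: lin_comp (mull _) (mulr _).
move: x; apply: (@span_ext id) => // [|b].
  exact: lin_comp (tlift_lin _) (lin_comp (tmap_lin _ _) Dl).
rewrite {1}(bb_delta bA) (lin_sum _ _ _ (tmap_lin _ _)) tlift_sum.
transitivity (\sum_(c | right c == right b)
   mul (if gunit (top (hquo b c))
        then \sum_(u | right u == gsrc (right (hquo b c))) e u else 0) (S (e c))).
  apply: eq_bigr => c _; rewrite tmap_tens // tlift_tens_bilin; last first.
    split=> [t|u]; first exact: tlift_lin.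
    by apply: tlift_param => s s'; apply: lin_comp (mulr _) Sl.
  rewrite tlift_D // -antipode_s_box (lin_sum _ _ _ (mull _)).
  by [].
rewrite (bigD1 b) //= gunit_top_hquo // eqxx [X in _ + X]big1 ?addr0; last first.
  move=> c /andP[/eqP er nc]; rewrite gunit_top_hquo // (negPf nc).
  exact: lin0 (mull _).
have [_ -> _ _] := hquoP mHK (erefl (right b)).
have [t1 r1 _ _] := hvinvP mHK b.
rewrite (bb_S bA) (lin_sum _ _ _ (mull _)).
have [|||tw rw] := @mkboxP _ H K b (ginv (bottom b)) (gsrc (left b)).
- exact: (memK_inv mHK) (bottomK mHK _).
- exact: (memH_unit mHK) (gunit_src _).
- by rewrite gsrc_inv grng_src src_left.
set w := mkbox _ _ in tw rw; have uw : gunit (right w) by rewrite rw gunit_src.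
have [_ _ bw] := gunit_right mHK uw.
rewrite (bigD1 w) /= ?rw // (bb_mul bA) bw tw t1 eqxx big1 ?addr0; last first.
  move=> u /andP[/eqP ru nu].
  have uu : gunit (right u) by rewrite ru gunit_src.
  have [_ _ bu] := gunit_right mHK uu.
  rewrite (bb_mul bA) bu t1; case: eqP => // tu.
  by case/eqP: nu; apply: box_inj; rewrite ?tw ?rw.
have [|t2 r2 _ _] := @vmulP _ _ _ mHK w (hvinv_box b); first by rewrite bw tw t1.
congr e; apply: box_inj; first by rewrite t2 tw t1.
by rewrite r2 rw r1 gunit_mul ?gunit_src // gsrc_src grng_inv.
Qed.

Lemma weak_hopf_of_boxes : cstar_algebra A -> weak_hopf_cstar A.
Proof.
move=> cA; split=> //.
- exact: delta_sub.
- exact: S_sub.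
- exact: box_coassoc.
- exact: box_counitl.
- exact: box_counitr.
- exact: box_delta_mul.
- exact: box_delta_star.
- exact: box_delta_one1.
- exact: box_delta_one2.
- exact: box_eps_mul1.
- exact: box_eps_mul2.
- exact: box_antipode_t.
- exact: box_antipode_s.
- exact: box_antipode.
Qed.

End BoxBasis.

(** * The algebra of the double groupoid *)

Section BoxAlgebra.
Variables (C : numClosedFieldType) (G : finGroupoid) (H K : {set G}).
Hypothesis mHK : match_pair H K.
Local Notation box := (box H K).
Local Notation chi := (chi C H K).
Implicit Types (b c d : box) (F : l2 C box).

Lemma chiE b c : chi (val b) c = (c == b)%:R.
Proof. by rewrite ffunE (inj_eq val_inj). Qed.

Lemma val_box b : val b = (top b, right b).
Proof. by rewrite /top /right; case: (val b). Qed.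

Lemma ev_chi b q : ev (chi (val b)) q = (q == val b)%:R.
Proof.
rewrite /ev; case: insubP => [c _ <-|]; first by rewrite ffunE.
by case: eqP => // -> /negP[]; apply: valP.
Qed.

Lemma sum_chi (V : lmodType C) b (f : box -> V) : \sum_c chi (val b) c *: f c = f b.
Proof.
rewrite (bigD1 b) //= chiE eqxx scale1r big1 ?addr0 // => c nc.
by rewrite chiE (negPf nc) scale0r.
Qed.

Lemma l2_chi F : F = \sum_b F b *: chi (val b).
Proof.
apply/ffunP=> c; rewrite sum_ffunE (bigD1 c) //= ffunE chiE eqxx big1.
  by rewrite addr0 /GRing.scale /= mulr1.
by move=> b nb; rewrite ffunE chiE eq_sym (negPf nb) /GRing.scale /= mulr0.
Qed.

Lemma chi_ext (sigma : C -> C) (V : lmodType C) (f g : l2 C box -> V) :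
    sigma 1 = 1 -> semilinear_over sigma f -> semilinear_over sigma g ->
  (forall b, f (chi (val b)) = g (chi (val b))) -> forall F, f F = g F.
Proof.
move=> s1 fl gl fg F; rewrite (l2_chi F).
rewrite (semilin_sum _ _ _ s1 fl) (semilin_sum _ _ _ s1 gl); apply: eq_bigr => b _.
by rewrite (semilinZ _ _ s1 fl) (semilinZ _ _ s1 gl) fg.
Qed.

Lemma comb_lin (V : lmodType C) (f : box -> V) : linear (fun F => \sum_b F b *: f b).
Proof.
move=> k F F'; rewrite scaler_sumr -big_split; apply: eq_bigr => b _.
by rewrite !ffunE scalerDl scalerA.
Qed.

(** The box [d] is a default value: the arrows of [H] composable with [k] are the
  right edges of the boxes with top edge [k]. *)
Lemma sum_right (V : nmodType) k d (f : G -> V) : k \in K ->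
  \sum_(h in H | grng h == gsrc k) f h = \sum_(c : box | top c == k) f (right c).
Proof.
move=> kK; rewrite (reindex_onto (@right G H K) (fun h => mkbox d (k, h))) /=.
  apply: eq_bigl => c; rewrite rightH /=.
  apply/andP/eqP => [[/eqP er /eqP <-]|ek].
    by have [->] := mkboxP d kK (rightH c) (esym er).
  have er : gsrc k = grng (right c) by rewrite -src_top ek.
  have [t r] := mkboxP d kK (rightH c) er.
  by rewrite er eqxx; split=> //; apply/eqP/box_inj; rewrite ?t ?r.
by move=> h /andP[hH /eqP er]; have [] := mkboxP d kK hH (esym er).
Qed.

Lemma convE F F' b : conv F F' b
  = \sum_(c | top c == top b)
      F c * ev F' (bottom c, ginv (right c) ** right b).
Proof.
rewrite ffunE; under eq_bigl do rewrite -src_top.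
rewrite (sum_right b (fun h => ev F (top b, h) *
  ev F' (ract H K (top b) h, ginv h ** right b)) (topK b)).
by apply: eq_bigr => c /eqP <-; rewrite (@ev_box _ _ _ _ F c).
Qed.

Lemma conv_chi b c : conv (chi (val b)) (chi (val c))
  = if vcomposable b c then chi (vcomp b c) else 0.
Proof.
apply/ffunP=> d; rewrite convE big_mkcond (bigD1 b) //= big1 ?addr0; last first.
  by move=> b' nb; case: ifP => // _; rewrite chiE (negPf nb) mul0r.
rewrite chiE eqxx mul1r ev_chi val_box xpair_eqE /vcomposable.
case: (bottom b =P top c) => [e|_]; last by rewrite ffunE; case: ifP.
have [t r _ _] := vmulP mHK e.
have sr : gsrc (right b) = grng (right c) by rewrite -src_bottom // e src_top.
rewrite -(val_vmul mHK e) chiE /=; case: (top b =P top d) => [et|nt]; last first.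
  by case: eqP => // ed; case: nt; rewrite ed t.
have rr : grng (right b) = grng (right d) by rewrite -!src_top et.
congr (nat_of_bool _)%:R; apply/eqP/eqP => [E|->]; last by rewrite r gmulKV.
by apply: box_inj; rewrite ?t // r -E gmulVK.
Qed.


Lemma sharp_chi b : sharp (chi (val b)) = chi (vinv b).
Proof.
apply/ffunP=> d; rewrite !ffunE ev_chi conjC_nat -!(val_vinv mHK) !(inj_eq val_inj).
by rewrite (can2_eq (vinv_boxK mHK) (vinv_boxK mHK)).
Qed.

Lemma dg_mul_bilin : bilinear_map (@dg_mul C G H K).
Proof.
split=> [F'|F] k F1 F2; rewrite /dg_mul scaler_sumr -big_split; apply: eq_bigr => b _;
  rewrite scaler_sumr -big_split; apply: eq_bigr => c _; rewrite !ffunE /=.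
  by rewrite mulrDl scalerDl -mulrA scalerA.
by rewrite mulrDr scalerDl mulrCA scalerA.
Qed.

Lemma dg_mul_chi b c : dg_mul (chi (val b)) (chi (val c))
  = if bottom b == top c then chi (val (vmul b c)) else 0.
Proof.
rewrite /dg_mul; under eq_bigr => b' _.
  under eq_bigr do rewrite -scalerA.
  rewrite -scaler_sumr; over.
rewrite (sum_chi _ (fun b' => \sum_(c' | vcomposable b' c')
  chi (val c) c' *: chi (vcomp b' c'))) big_mkcond (bigD1 c) //= big1 ?addr0; last first.
  by move=> c' nc; case: ifP => // _; rewrite chiE (negPf nc) scale0r.
rewrite /vcomposable; case: eqP => // e.
by rewrite chiE eqxx scale1r val_vmul.
Qed.

Lemma dg_star_semilin : semilinear_over (fun c : C => c^*) (@dg_star C G H K).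
Proof.
move=> k F F'; rewrite /dg_star scaler_sumr -big_split; apply: eq_bigr => b _.
by rewrite !ffunE rmorphD rmorphM scalerDl scalerA.
Qed.

Lemma dg_star_chi b : dg_star (chi (val b)) = chi (val (vinv_box b)).
Proof.
rewrite val_vinv // -[RHS](sum_chi b (fun b => chi (vinv b))); apply: eq_bigr => c _.
by rewrite chiE conjC_nat.
Qed.

Lemma dg_one_chi : dg_one C H K = \sum_(b : box | gunit (right b)) chi (val b).
Proof.
rewrite [LHS]l2_chi [RHS]big_mkcond; apply: eq_bigr => b _.
by rewrite ffunE; case: ifP; rewrite ?scale1r ?scale0r.
Qed.

Lemma dg_delta_lin : linear (@dg_delta C G H K).
Proof. exact: comb_lin. Qed.

Lemma dg_S_lin : linear (@dg_S C G H K).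
Proof. exact: comb_lin. Qed.

Lemma dg_eps_lin : scalar (@dg_eps C G H K).
Proof.
move=> k F F'; rewrite /dg_eps mulr_sumr -big_split; apply: eq_bigr => b _.
by rewrite !ffunE.
Qed.

(** A horizontal factorization of [b] is determined by its right factor. *)
Lemma sum_hfactor (V : nmodType) b (f : box -> box -> V) :
  \sum_(bb : box * box | hcomposable bb.1 bb.2 && (hcomp bb.1 bb.2 == val b))
    f bb.1 bb.2
  = \sum_(c | right c == right b) f (hquo b c) c.
Proof.
rewrite big_mkcond -(pair_bigA _ (fun b1 b2 =>
  if hcomposable b1 b2 && (hcomp b1 b2 == val b) then f b1 b2 else 0)) /=.
rewrite exchange_big [RHS]big_mkcond; apply: eq_bigr => c _.
have hE b' : hcomposable b' c && (hcomp b' c == val b)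
    = (right c == right b) && (b' == hquo b c).
  apply/andP/andP=> [[/eqP e E]|[/eqP er /eqP->]].
    have er : right c = right b by rewrite [RHS]/right -(eqP E).
    rewrite er eqxx -(hmul_hquo mHK e) //; split=> //.
    by rewrite -(inj_eq val_inj) val_hmul.
  have [_ r l _] := hquoP mHK (esym er).
  split; first by rewrite /hcomposable r.
  by rewrite -(val_hmul mHK r) (inj_eq val_inj) hmul_hquoK.
under eq_bigr do rewrite hE.
case: eqP => [er|_] /=; last by rewrite big1.
by rewrite -big_mkcond /= big_pred1_eq.
Qed.

Lemma dg_delta_chi b : dg_delta (chi (val b))
  = \sum_(c | right c == right b) tens (chi (val (hquo b c))) (chi (val c)).
Proof.
rewrite /dg_delta sum_chi.
exact: (sum_hfactor b (fun c d => tens (chi (val c)) (chi (val d)))).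
Qed.

Lemma dg_S_chi b : dg_S (chi (val b)) = chi (val (hvinv_box b)).
Proof. by rewrite /dg_S sum_chi val_hvinv. Qed.

Lemma dg_eps_chi b : dg_eps (chi (val b)) = (gunit (top b))%:R.
Proof.
rewrite /dg_eps big_mkcond (bigD1 b) //= chiE eqxx big1 ?addr0.
  by case: ifP.
by move=> c nc; rewrite chiE (negPf nc); case: ifP.
Qed.

(** The right regular representation of the vertical groupoid. *)
Lemma Rdelta_chiE b (xi : l2 C box) d :
  Rdelta (chi (val b)) xi d = (bottom d == top b)%:R * xi (vmul d b).
Proof.
rewrite RdeltaE // -src_bottom //.
rewrite (sum_right (vinv_box d) (fun h => ev (chi (val b)) (bottom d, h) *
  ev xi (top d, right d ** h)) (bottomK mHK d)).
have [eb|nb] := eqVneq (bottom d) (top b); last first.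
  rewrite mul0r big1 // => c /eqP ec; rewrite ev_chi.
  case: eqP => [e|]; last by rewrite mul0r.
  by case/eqP: nb; rewrite /top -e.
have [t r _ _] := vmulP mHK eb.
rewrite (bigD1 b) /= ?eb // (ev_box _ (b := b)) // chiE eqxx.
rewrite (ev_box _ (b := vmul d b)) // big1 ?addr0 // => c /andP[/eqP ec nc].
by rewrite -ec (ev_box _ (b := c)) // chiE (negPf nc) mul0r.
Qed.

Lemma entry_Rdelta_chi b d d' :
  entry (Rdelta (chi (val b))) d d' = ((bottom d == top b) && (vmul d b == d'))%:R.
Proof. by rewrite /entry Rdelta_chiE ffunE -natrM mulnb. Qed.

Lemma vmulA b c d : bottom b = top c -> bottom c = top d ->
  vmul (vmul b c) d = vmul b (vmul c d).
Proof.
move=> e e'; have [t1 r1 _ b1] := vmulP mHK e; have [t2 r2 _ b2] := vmulP mHK e'.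
have [|t3 r3 _ _] := @vmulP _ _ _ mHK (vmul b c) d; first by rewrite b1.
have [|t4 r4 _ _] := @vmulP _ _ _ mHK b (vmul c d); first by rewrite t2.
apply: box_inj; rewrite ?t3 ?t4 // r3 r4 r1 r2 gmulA //.
  by rewrite -src_bottom // e src_top.
by rewrite -src_bottom // e' src_top.
Qed.

Lemma Rdelta_mul F F' : Rdelta (dg_mul F F') = (Rdelta F \o Rdelta F')%VF.
Proof.
have Rl := @Rdelta_lin C G H K; have [ml mr] := dg_mul_bilin.
move: F; apply: (@chi_ext id) => // [||b].
- exact: lin_comp Rl (ml _).
- by move=> k F1 F2; rewrite Rl comp_lfunDl comp_lfunZl.
move: F'; apply: (@chi_ext id) => // [||c].
- exact: lin_comp Rl (mr _).
- by move=> k F1 F2; rewrite Rl comp_lfunDr comp_lfunZr.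
rewrite dg_mul_chi; apply/lfunP=> xi; apply/ffunP=> d.
rewrite comp_lfunE /= Rdelta_chiE Rdelta_chiE.
case: (bottom d =P top b) => [e|n]; last first.
  rewrite mul0r; case: eqP => [e'|_]; last by rewrite (lin0 Rl) lfunE /= ffunE.
  rewrite Rdelta_chiE; have [-> _ _ _] := vmulP mHK e'.
  by case: eqP => // e; rewrite ?mul0r.
have [_ _ _ ->] := vmulP mHK e; rewrite mul1r.
case: eqP => [e'|_]; last by rewrite (lin0 Rl) lfunE /= ffunE mul0r.
rewrite Rdelta_chiE; have [-> _ _ _] := vmulP mHK e'.
by rewrite e eqxx !mul1r vmulA.
Qed.

(** Right division by [b] in the vertical groupoid; it makes the vertical
  inverse correspond to the adjoint in [Rdelta_star]. *)
Lemma vmulK b d d' : bottom d = top b -> vmul d b = d' ->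
  bottom d' = bottom b /\ vmul d' (vinv_box b) = d.
Proof.
move=> e <-; have [t r _ bo] := vmulP mHK e; have [t' r' _ _] := vinvP mHK b.
split=> //; have [|t2 r2 _ _] := @vmulP _ _ _ mHK (vmul d b) (vinv_box b).
  by rewrite bo t'.
apply: box_inj; rewrite ?t2 // r2 r r' -gmulA ?grng_inv //.
  by rewrite gmulxV -src_top -e src_bottom // gmul_src.
by rewrite -src_bottom // e src_top.
Qed.

Lemma Rdelta_star F : Rdelta (dg_star F) = opadj (Rdelta F).
Proof.
have Rl := @Rdelta_lin C G H K.
move: F; apply: (@chi_ext (fun c : C => c^*)) => // [||k F F'|b].
- exact: rmorph1.
- by move=> k F F'; rewrite dg_star_semilin Rl.
- by rewrite Rl opadj_semilin.
rewrite dg_star_chi; apply: entry_inj => d d'.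
rewrite entry_adj !entry_Rdelta_chi conjC_nat; congr (nat_of_bool _)%:R.
have [t r _ bo] := vinvP mHK b; rewrite t.
apply/andP/andP => -[/eqP e /eqP E].
  have [] := @vmulK (vinv_box b) d d' _ E; first by rewrite t.
  by rewrite bo (vinv_boxK mHK) => -> ->; rewrite !eqxx.
by have [-> ->] := vmulK e E; rewrite !eqxx.
Qed.

Lemma bottom_unit_box d : exists2 b, gunit (right b) & bottom d = top b /\ vmul d b = d.
Proof.
have [|||t r] := @mkboxP _ H K d (bottom d) (gsrc (right d)).
- exact: bottomK.
- exact: (memH_unit mHK) (gunit_src _).
- by rewrite grng_src src_bottom.
exists (mkbox d (bottom d, gsrc (right d))); first by rewrite r gunit_src.
have [|t' r' _ _] := @vmulP _ _ _ mHK d (mkbox d (bottom d, gsrc (right d))).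
  by rewrite t.
by split=> //; apply: box_inj; rewrite ?t' // r' r gmul_src.
Qed.

Lemma top_unit_box b : exists2 d, gunit (right d) & bottom d = top b /\ vmul d b = b.
Proof.
have [|||t r] := @mkboxP _ H K b (top b) (grng (right b)).
- exact: topK.
- exact: (memH_unit mHK) (gunit_rngx _).
- by rewrite grng_rng src_top.
exists (mkbox b (top b, grng (right b))); first by rewrite r gunit_rngx.
have u : gunit (right (mkbox b (top b, grng (right b)))) by rewrite r gunit_rngx.
have [_ _ bo] := gunit_right mHK u.
have [|t' r' _ _] := @vmulP _ _ _ mHK (mkbox b (top b, grng (right b))) b.
  by rewrite bo t.
by rewrite bo t; split=> //; apply: box_inj; rewrite ?t' // r' r gmul_rng.
Qed.

Lemma Rdelta_one : Rdelta (dg_one C H K) = \1%VF.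
Proof.
rewrite dg_one_chi (lin_sum _ _ _ (@Rdelta_lin C G H K)).
apply: entry_inj => d d'; rewrite entry_sum entry1.
have [b ub [tb E]] := bottom_unit_box d.
rewrite (bigD1 b) //= entry_Rdelta_chi tb eqxx E big1 ?addr0 // => c /andP[uc nc].
rewrite entry_Rdelta_chi; case: eqP => // e; case/eqP: nc.
have [rb _ _] := gunit_right mHK ub; have [rc _ _] := gunit_right mHK uc.
by apply: box_inj; rewrite ?rb ?rc -e tb.
Qed.

(** The coefficient of [b] is read off between the vertical identity of its top
  edge and [b] itself. *)
Lemma Rdelta_inj : injective (@Rdelta C G H K).
Proof.
move=> F F' E; apply/ffunP=> b.
have [d ud [bd E1]] := top_unit_box b.
have h (f : l2 C box) : f b = entry (Rdelta f) d b.
  rewrite {2}(l2_chi f) (lin_sum _ _ _ (@Rdelta_lin C G H K)) entry_sum (bigD1 b) //=.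
  rewrite (linZ _ _ (@Rdelta_lin C G H K)) entryZ entry_Rdelta_chi bd E1 !eqxx mulr1.
  rewrite big1 ?addr0 // => c nc.
  rewrite (linZ _ _ (@Rdelta_lin C G H K)) entryZ entry_Rdelta_chi.
  case: eqP => [e|_]; last by rewrite mulr0.
  case: eqP => [e2|_]; last by rewrite mulr0.
  case/eqP: nc; have [_ r _ _] := vmulP mHK e; apply: box_inj; first by rewrite -e bd.
  by rewrite -e2 r gunit_mul // -src_bottom // e src_top.
by rewrite !h E.
Qed.

End BoxAlgebra.

(** * The operators on the functions on the groupoid *)

Section GroupoidOperators.
Variables (C : numClosedFieldType) (G : finGroupoid) (H K : {set G}).
Hypothesis mHK : match_pair H K.
Local Notation box := (box H K).
Local Notation chi := (chi C H K).
Local Notation p1 := (p1 H K).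
Local Notation p2 := (p2 H K).
Local Notation pull := (pull C H K).
Local Notation RG := (@RdeltaG C G H K).
Implicit Types (b c d : box) (F : l2 C box) (x y g : G).

Let RGl : linear RG := @RdeltaG_lin C G H K.

Lemma p_mulHl h g : h \in H -> gsrc h = grng g ->
  p1 (h ** g) = h ** p1 g /\ p2 (h ** g) = p2 g.
Proof.
move=> hH e; have [aH kK ek eg] := p_dec mHK g.
have ea : gsrc h = grng (p1 g) by rewrite rng_p1.
rewrite -{1 3}eg gmulA //; apply: p_uniq => //; first exact: (memH_mul mHK).
by rewrite gsrc_mul.
Qed.

Lemma p2_mulKr g k : k \in K -> gsrc g = grng k -> p2 (g ** k) = p2 g ** k.
Proof.
move=> kK e; have [aH cK ea eg] := p_dec mHK g.
have ek : gsrc (p2 g) = grng k by rewrite src_p2.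
rewrite -{1}eg -gmulA //; apply: p2M => //; first exact: (memK_mul mHK).
by rewrite grng_mul.
Qed.

Lemma p2_mul_right b g : p2 g = top b -> p2 (g ** right b) = bottom b.
Proof.
move=> e; have [aH kK ek eg] := p_dec mHK g.
have sg : gsrc (p1 g) = grng (top b) by rewrite ek e.
rewrite -{1}eg e -gmulA ?src_top //.
have [|_ ->] := @p_mulHl (p1 g) (top b ** right b) aH; last exact: p2_mul_box.
by rewrite grng_mul ?src_top.
Qed.

(** Right multiplication by the right edge of [b], on the arrows of [G], is
  inverted by the vertical inverse of [b]. *)
Lemma mul_rightK b x y : p2 x = top b -> x ** right b = y ->
  p2 y = bottom b /\ y ** ginv (right b) = x.
Proof.
move=> e <-; split; first exact: p2_mul_right.
have er : gsrc x = grng (right b) by rewrite -(src_p2 mHK) e src_top.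
by rewrite -gmulA ?grng_inv // gmulxV -er gmul_src.
Qed.

Lemma pullK : (pull \o pull^-1)%VF = \1%VF.
Proof.
apply/lfunP=> xi; rewrite comp_lfunE limg_lfunVK ?lfunE //.
by rewrite pull_im ?memvf.
Qed.

Lemma pullVK : (pull^-1 \o pull)%VF = \1%VF.
Proof.
by apply/lfunP=> xi; rewrite comp_lfunE lker0_lfunK ?lfunE // pull_ker.
Qed.

Lemma RdeltaG_mul F F' : RG (dg_mul F F') = (RG F \o RG F')%VF.
Proof.
rewrite /RdeltaG Rdelta_mul // !comp_lfunA; congr (_ \o _)%VF.
by rewrite -!comp_lfunA [(pull \o (_ \o _))%VF]comp_lfunA pullK comp_lfun1l.
Qed.

Lemma RdeltaG_one : RG (dg_one C H K) = \1%VF.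
Proof. by rewrite /RdeltaG Rdelta_one // comp_lfun1r pullVK. Qed.

Lemma RdeltaG_inj : injective RG.
Proof.
have h F : Rdelta F = (pull \o RG F \o pull^-1)%VF.
  rewrite /RdeltaG !comp_lfunA pullK comp_lfun1l -comp_lfunA pullK.
  by rewrite comp_lfun1r.
by move=> F F' E; apply: (Rdelta_inj mHK); rewrite !h E.
Qed.

Lemma RdeltaG_star F : RG (dg_star F) = opadj (RG F).
Proof.
move: F; apply: (@chi_ext _ _ _ _ (fun c : C => c^*)) => // [||k F F'|b].
- exact: rmorph1.
- by move=> k F F'; rewrite dg_star_semilin RGl.
- by rewrite RGl opadj_semilin.
rewrite dg_star_chi //; apply: entry_inj => x y.
rewrite entry_adj !entry_RG // conjC_nat; congr (nat_of_bool _)%:R.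
have [t r _ bo] := vinvP mHK b; rewrite t r.
apply/andP/andP => -[/eqP e /eqP E].
  have [||] := @mul_rightK (vinv_box b) x y; rewrite ?t ?r // bo ginvK => -> ->.
  by rewrite !eqxx.
by have [-> ->] := mul_rightK e E; rewrite !eqxx.
Qed.

(** ** The coproduct *)

(** The isometry maps basis vectors to basis vectors or to 0; the pair [(a, b)]
  that it relates to [(x, y)] satisfies [x = a ** p1 y] and [b = p2 a ** y]. *)
Lemma opadj_IopE (f : l2 C (G * G)%type) x y :
  opadj (Iop C H K) f (x, y) = if gsrc x == gsrc (p1 y)
    then let a := x ** ginv (p1 y) in f (a, p2 a ** y) else 0.
Proof.
rewrite op_entryE /=; set a := x ** ginv (p1 y).
have E q : entry (opadj (Iop C H K)) (x, y) q
    = ((gsrc x == gsrc (p1 y)) && (q == (a, p2 a ** y)))%:R.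
  case: q => a' b'; rewrite entry_adj entry_Iop // conjC_nat xpair_eqE.
  congr (nat_of_bool _)%:R.
  apply/and3P/and3P => -[/eqP e1 /eqP e2 /eqP e3].
    have ra : gsrc a' = grng (p1 y).
      by rewrite rng_p1 // -e3 grng_mul ?grng_inv ?src_p2 // gsrc_inv.
    rewrite e3 in e2; have sx : gsrc x = gsrc (p1 y) by rewrite -e2 gsrc_mul.
    have ea : a' = a.
      by rewrite /a -e2 -gmulA ?grng_inv // gmulxV -ra gmul_src.
    by split; apply/eqP => //; rewrite -ea -e3 gmulVK.
  have sa : gsrc a = grng y by rewrite gsrc_mul ?grng_inv // gsrc_inv rng_p1.
  rewrite e2 e3; have e : gsrc (p2 a) = grng y by rewrite src_p2.
  rewrite gmulKV // grng_mul // !eqxx; split=> //; apply/eqP.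
  rewrite /a -gmulA ?grng_inv ?gsrc_inv // gmulVx -e1.
  by rewrite gmul_src.
under eq_bigr do rewrite E.
case: eqP => _ /=; last by rewrite big1 // => q _; rewrite mul0r.
rewrite (bigD1 (a, p2 a ** y)) //= eqxx mul1r big1 ?addr0 // => q /negPf->.
by rewrite mul0r.
Qed.

Lemma optens_chiE b c (f : l2 C (G * G)%type) x y :
  optens (RG (chi (val b))) (RG (chi (val c))) f (x, y)
  = ((p2 x == top b) && (p2 y == top c))%:R * f (x ** right b, y ** right c).
Proof.
rewrite /optens op_ofE (bigD1 (x ** right b, y ** right c)) //= !entry_RG //.
rewrite !eqxx !andbT -natrM mulnb big1 ?addr0 // => -[x' y'].
rewrite xpair_eqE negb_and => /orP[n|n] /=; rewrite !entry_RG //= [_ == x']eq_sym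
  [_ == y']eq_sym (negPf n) andbF ?mul0r ?mulr0 ?mul0r //.
Qed.

Lemma optens1_chiE b (f : l2 C (G * G)%type) x y :
  optens \1%VF (RG (chi (val b))) f (x, y)
  = (p2 y == top b)%:R * f (x, y ** right b).
Proof.
rewrite /optens op_ofE (bigD1 (x, y ** right b)) //= entry1 entry_RG //.
rewrite !eqxx !andbT mul1r big1 ?addr0 // => -[x' y'].
rewrite xpair_eqE negb_and => /orP[n|n] /=; rewrite entry1 entry_RG //=.
  by rewrite eq_sym (negPf n) !mul0r.
by rewrite [_ == y']eq_sym (negPf n) andbF mulr0 mul0r.
Qed.

Lemma Gamma_lin : linear (@Gamma C G H K).
Proof.
have tl : linear (fun T : op C G => optens (\1%VF : op C G) T).
  move=> k S T; apply: entry_inj => x y.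
  by rewrite entryD entryZ !entry_op_of entryD entryZ mulrDr mulrCA.
move=> k S T; rewrite /Gamma tl.
by rewrite comp_lfunDl comp_lfunDr comp_lfunZr comp_lfunZl.
Qed.

(** Both sides translate [(x, y)] on the right, with support given by
  [p2 x ** p2 y = top b]; the factorization of [b] involved is the one whose
  right factor has top edge [p2 y]. *)
Lemma Gamma_chi b : Gamma H K (RG (chi (val b)))
  = \sum_(c | right c == right b)
      optens (RG (chi (val (hquo b c)))) (RG (chi (val c))).
Proof.
apply/lfunP=> f; apply/ffunP=> -[x y].
rewrite sum_lfunE sum_ffunE /Gamma !comp_lfunE opadj_IopE /=.
under [RHS]eq_bigr do rewrite optens_chiE.
rewrite optens1_chiE.
have [p1H' p2K' ep epy] := p_dec mHK y.
set a := x ** ginv (p1 y).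
(* Write [x] as [p1 a ** (p2 a ** p1 y)]: removing the left factor in [H] does
   not change the component along [K]. *)
have key : gsrc x = gsrc (p1 y) -> p2 (p2 a ** y) = p2 x ** p2 y
    /\ a ** p1 y = x /\ gsrc a = grng y.
  move=> sx.
  have sa : gsrc a = grng y by rewrite gsrc_mul ?grng_inv // gsrc_inv rng_p1.
  have eax : a ** p1 y = x.
    by rewrite /a -gmulA ?grng_inv ?gsrc_inv // gmulVx -sx gmul_src.
  have [bH cK ebc ea] := p_dec mHK a.
  have sc : gsrc (p2 a) = grng (p1 y) by rewrite src_p2 // rng_p1.
  split=> //; rewrite -[in LHS]epy gmulA // p2_mulKr ?gsrc_mul //; congr (_ ** _).
  rewrite -[in RHS]eax -[in RHS]ea -gmulA //.
  by have [|_ ->] := @p_mulHl (p1 a) (p2 a ** p1 y) bH; rewrite ?grng_mul.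
have [P|nP] := boolP ((gsrc x == gsrc (p1 y)) && (p2 (p2 a ** y) == top b)); last first.
  transitivity (0 : C).
    by move: nP; case: (gsrc x == _) => //= /negPf->; rewrite mul0r.
  rewrite big1 // => c /eqP er; case: (p2 x =P _) => [ex|_]; last by rewrite mul0r.
  case: (p2 y =P _) => [ey|_]; last by rewrite mul0r.
  have [t _ _ _] := hquoP mHK (esym er).
  have st : gsrc (top b) = gsrc (top c) by rewrite !src_top er.
  have sx : gsrc x = gsrc (p1 y).
    rewrite -(src_p2 mHK) ex t gsrc_mul ?grng_inv // gsrc_inv.
    by rewrite -ey.
  case/negP: nP; have [-> _] := key sx; rewrite sx eqxx ex ey t /=.
  by rewrite -gmulA ?grng_inv ?gsrc_inv // gmulVx -st gmul_src.
case/andP: P => /eqP sx /eqP E; have [Ek [eax sa]] := key sx.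
rewrite sx eqxx E eqxx mul1r.
have sy : gsrc y = grng (right b).
  rewrite -src_top -E src_p2 // gsrc_mul //.
  by rewrite src_p2.
have [|||t r] := @mkboxP _ H K b (p2 y) (right b).
- by [].
- exact: rightH.
- by rewrite src_p2.
set c := mkbox _ _ in t r.
have [tq rq _ _] := hquoP mHK (esym r).
have st : gsrc (p2 x) = grng (p2 y) by rewrite src_p2 // sx.
have tx : top (hquo b c) = p2 x.
  rewrite tq t -E Ek -gmulA ?grng_inv // gmulxV -st gmul_src //.
rewrite (bigD1 c) /= ?r // tx t !eqxx mul1r big1 ?addr0; last first.
  move=> d /andP[/eqP er nd]; case: (p2 y =P top d) => [ed|_].
    by case/eqP: nd; apply: box_inj; rewrite ?t ?r.
  by rewrite andbF mul0r.
have sp : gsrc (p2 a) = grng (y ** right b) by rewrite src_p2 // grng_mul.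
rewrite -gmulA ?src_p2 // IopE // midE // grng_mul // eqxx gmulKV //.
have -> : p1 (y ** right b) = p1 y ** left c.
  rewrite -[in LHS]epy -gmulA ?src_p2 //.
  have [|-> _] := @p_mulHl (p1 y) (p2 y ** right b) p1H'.
    by rewrite grng_mul // src_p2.
  by rewrite /left /lact t r.
rewrite rq gmulA ?eax //.
  by rewrite sa rng_p1.
by rewrite rng_left // t.
Qed.

(** ** The antipode and the counit *)

(** The slices determine the values of the linear form on the operators [Uop],
  and [RG (chi (val b))] has a single nonzero coordinate. *)
Lemma slice_repr b : exists2 omega : 'Hom(op C G, C^o),
    RG (chi (val b)) = slice (Iop C H K) omega
  & forall d, omega (Uop C d) = (d == b)%:R.
Proof.
have : RG (chi (val b)) \in Shat C H K.
  rewrite -crossed_Shat // -(linfun_lin RGl); exact: memv_img (memvf _).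
case/memv_imgP=> omega _; rewrite sliceIE // => E; exists omega => // d.
rewrite omega_Uop // -E entry_RG // p2K ?topK //; congr (nat_of_bool _)%:R.
apply/andP/eqP => [[/eqP et /eqP er]|->]; last by rewrite !eqxx.
apply: box_inj => //; apply: (@gmulI _ (top d)); rewrite ?er ?src_top //.
by rewrite -!src_top et.
Qed.

Lemma kappa_chi b : kappa H K (RG (chi (val b))) = RG (chi (val (hvinv_box b))).
Proof.
have [omega -> om] := slice_repr b; rewrite kappa_slice // slice_adjE //.
apply: entry_inj => x y; rewrite entry_op_of entry_RG //.
under eq_bigr do rewrite om.
rewrite big_mkcond (bigD1 b) //= eqxx big1 ?addr0; last first.
  by move=> d nd; rewrite (negPf nd); case: ifP.
rewrite -mulrb; congr (nat_of_bool _)%:R.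
have [t r _ bo] := hvinvP mHK b; have [t' r' _ bo'] := vinvP mHK (hvinv_box b).
apply/andP/andP => -[/eqP e /eqP E].
  have [||] := @mul_rightK (vinv_box (hvinv_box b)) y x.
  - by rewrite t' bo e ginvK.
  - by rewrite r' r ginvK.
  by rewrite bo' r' ginvK => -> ->; rewrite !eqxx.
have [] := mul_rightK e E; rewrite bo r ginvK => -> ->.
by rewrite ginvK !eqxx.
Qed.

Lemma eps_chi b : eps H K (RG (chi (val b))) = (gunit (top b))%:R.
Proof.
have [omega -> om] := slice_repr b; rewrite eps_slice // (lfun1_Uop _ mHK) linear_sum.
rewrite big_mkcond (bigD1 b) //= om eqxx big1 ?addr0.
  by case: ifP.
by move=> d nd; rewrite om (negPf nd); case: ifP.
Qed.

Lemma kappa_lin : linear (@kappa C G H K).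
Proof.
move=> k S T; rewrite /kappa linearP; exact: slice_lin.
Qed.

Lemma eps_lin : scalar (@eps C G H K).
Proof. by move=> k S T; rewrite /eps linearP add_lfunE scale_lfunE. Qed.

Lemma crossed_delta_chi b : wh_delta (w := crossed_wh C H K) (RG (chi (val b)))
  = \sum_(c | right c == right b)
      tens (RG (chi (val (hquo b c)))) (RG (chi (val c))).
Proof.
rewrite /= Gamma_chi; apply: (canLR (lker0_lfunK _)).
  by case: (tens_op_bij C G).
rewrite [RHS]linear_sum; apply: eq_bigr => c _; exact: esym (tens_op_tens _ _).
Qed.

Lemma mem_crossed (T : op C G) :
  T \in crossed C H K -> exists F, T = RG F.
Proof. by case/memv_imgP=> F _ ->; exists F; rewrite linfun_lin. Qed.

Lemma RdeltaG_crossed F : RG F \in crossed C H K.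
Proof. by rewrite -(linfun_lin RGl) memv_img ?memvf. Qed.

Lemma mem_crossed_box (T : op C box) :
  T \in crossed_box C H K -> exists F, T = Rdelta F.
Proof.
by case/memv_imgP=> F _ ->; exists F; rewrite linfun_lin //; apply: Rdelta_lin.
Qed.

Lemma Rdelta_crossed_box F : Rdelta F \in crossed_box C H K.
Proof.
by rewrite -(linfun_lin (@Rdelta_lin C G H K)) memv_img ?memvf.
Qed.

(** ** The three *-algebras *)

(** The laws of the algebra of boxes are those of the operators representing
  it. *)
Lemma dg_starAlgP : starAlgP (dg_alg C H K).
Proof.
have [ml mr] := @dg_mul_bilin C G H K.
have inj := @Rdelta_inj C G H K mHK; have RM := @Rdelta_mul C G H K mHK.
have Rs := @Rdelta_star C G H K mHK; have R1 := @Rdelta_one C G H K mHK.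
split=> /=.
- by move=> a b x y c; apply: ml.
- by move=> a x y c; apply: mr.
- by move=> x y z; apply: inj; rewrite !RM comp_lfunA.
- by move=> x; apply: inj; rewrite RM R1 comp_lfun1l.
- by move=> x; apply: inj; rewrite RM R1 comp_lfun1r.
- by move=> x y c; apply: dg_star_semilin.
- by move=> x; apply: inj; rewrite !Rs opadjK.
- by move=> x y; apply: inj; rewrite !(Rs, RM) opadjM.
- exact: memvf.
- by move=> x y _ _; apply: memvf.
- by move=> x _; apply: memvf.
Qed.

Lemma op_starAlgP (X : finType) (V : {vspace op C X}) :
    \1%VF \in V -> (forall S T, S \in V -> T \in V -> (S \o T)%VF \in V) ->
    (forall T, T \in V -> opadj T \in V) ->
  starAlgP (@StarAlg C (op C X) V (fun S T => (S \o T)%VF) \1%VF (@opadj C X)).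
Proof.
move=> V1 VM Vs; split=> //=.
- by move=> a b x y c; rewrite comp_lfunDl comp_lfunZl.
- by move=> a x y c; rewrite comp_lfunDr comp_lfunZr.
- by move=> x y z; rewrite comp_lfunA.
- by move=> x; rewrite comp_lfun1l.
- by move=> x; rewrite comp_lfun1r.
- by move=> x y c; apply: opadj_semilin.
- exact: opadjK.
- exact: opadjM.
Qed.

Lemma crossed_box_starAlgP : starAlgP (crossed_box_alg C H K).
Proof.
apply: op_starAlgP.
- by rewrite -(Rdelta_one C mHK) Rdelta_crossed_box.
- move=> S T /mem_crossed_box[F ->] /mem_crossed_box[F' ->].
  by rewrite -Rdelta_mul // Rdelta_crossed_box.
- by move=> T /mem_crossed_box[F ->]; rewrite -Rdelta_star // Rdelta_crossed_box.
Qed.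

Lemma crossed_starAlgP : starAlgP (crossed_alg C H K).
Proof.
apply: op_starAlgP.
- by rewrite -RdeltaG_one RdeltaG_crossed.
- move=> S T /mem_crossed[F ->] /mem_crossed[F' ->].
  by rewrite -RdeltaG_mul RdeltaG_crossed.
- by move=> T /mem_crossed[F ->]; rewrite -RdeltaG_star RdeltaG_crossed.
Qed.

Lemma Rdelta_star_iso :
  star_iso (A := dg_alg C H K) (B := crossed_box_alg C H K) (@Rdelta C G H K).
Proof.
split=> /=.
- exact: Rdelta_lin.
- by move=> F _; apply: Rdelta_crossed_box.
- by move=> F F' _ _; apply: Rdelta_inj.
- by move=> T /mem_crossed_box[F ->]; exists F; rewrite ?memvf.
- by move=> F F' _ _; apply: Rdelta_mul.
- exact: Rdelta_one.
- by move=> F _; apply: Rdelta_star.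
Qed.

Lemma RdeltaG_star_iso : star_iso (A := dg_alg C H K) (B := crossed_alg C H K) RG.
Proof.
split=> /=.
- exact: RGl.
- by move=> F _; apply: RdeltaG_crossed.
- by move=> F F' _ _; apply: RdeltaG_inj.
- by move=> T /mem_crossed[F ->]; exists F; rewrite ?memvf.
- by move=> F F' _ _; apply: RdeltaG_mul.
- exact: RdeltaG_one.
- by move=> F _; apply: RdeltaG_star.
Qed.

(** ** The two weak Hopf algebras *)

Lemma dg_box_basis : box_basis (A := dg_wh C H K) (fun b => chi (val b)).
Proof.
split=> /=.
- by move=> F _; exists F; apply: l2_chi.
- by move=> b; apply: memvf.
- exact: dg_mul_chi.
- exact: dg_one_chi.
- exact: dg_star_chi.
- exact: dg_delta_chi.
- exact: dg_S_chi.
- exact: dg_eps_chi.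
Qed.

Lemma crossed_box_basis :
  box_basis (A := crossed_wh C H K) (fun b => RG (chi (val b))).
Proof.
split=> /=.
- move=> T /mem_crossed[F ->]; exists F.
  rewrite {1}(l2_chi F) (lin_sum _ _ _ RGl); apply: eq_bigr => b _.
  exact: linZ RGl.
- by move=> b; apply: RdeltaG_crossed.
- move=> b c; rewrite -RdeltaG_mul dg_mul_chi //; case: eqP => // _.
  exact: lin0 RGl.
- by rewrite -RdeltaG_one dg_one_chi (lin_sum _ _ _ RGl).
- by move=> b; rewrite -RdeltaG_star dg_star_chi.
- exact: crossed_delta_chi.
- exact: kappa_chi.
- exact: eps_chi.
Qed.

Lemma RdeltaG_structure F :
  [/\ wh_delta (w := crossed_wh C H K) (RG F) = tmap RG RG (dg_delta F),
      kappa H K (RG F) = RG (dg_S F) & eps H K (RG F) = dg_eps F].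
Proof.
have Dl : linear (@wh_delta C (crossed_wh C H K)).
  by move=> k S T; rewrite /= Gamma_lin linearP.
split; move: F.
- apply: (@chi_ext _ _ _ _ id) => // [||b].
  + exact: lin_comp Dl RGl.
  + exact: lin_comp (tmap_lin _ _) (@dg_delta_lin _ _ _ _).
  rewrite crossed_delta_chi dg_delta_chi // (lin_sum _ _ _ (tmap_lin _ _)).
  by apply: eq_bigr => c _; rewrite tmap_tens.
- apply: (@chi_ext _ _ _ _ id) => // [||b].
  + exact: lin_comp kappa_lin RGl.
  + exact: lin_comp RGl (@dg_S_lin _ _ _ _).
  by rewrite kappa_chi dg_S_chi.
- apply: (@chi_ext _ _ _ _ id C^o) => // [||b].
  + by move=> k F F'; rewrite RGl eps_lin.
  + exact: dg_eps_lin.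
  by rewrite eps_chi dg_eps_chi.
Qed.

End GroupoidOperators.

Section CstarStructure.
Variables (R : realType) (G : finGroupoid) (H K : {set G}).
Hypothesis mHK : match_pair H K.

Lemma dg_cstar : cstar_algebra (dg_alg R[i] H K).
Proof.
split; first exact: dg_starAlgP.
exists (fun F => opnorm (Rdelta F)); apply: cstar_norm_repr => /=.
- exact: Rdelta_lin.
- by move=> F _ E; apply: (Rdelta_inj mHK); rewrite E (lin0 (@Rdelta_lin _ _ _ _)).
- by move=> F F' _ _; apply: Rdelta_mul.
- by move=> F _; apply: Rdelta_star.
- by move=> F _; apply: memvf.
Qed.

Lemma crossed_box_cstar : cstar_algebra (crossed_box_alg R[i] H K).
Proof.
have P := crossed_box_starAlgP R[i] mHK; split=> //.
exists (fun T => opnorm T); apply: (cstar_norm_repr (A := crossed_box_alg R[i] H K) (f := fun T => T)) => //=.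
exact: (sa_star_sub P).
Qed.

Lemma crossed_cstar : cstar_algebra (crossed_alg R[i] H K).
Proof.
have P := crossed_starAlgP R[i] mHK; split=> //.
exists (fun T => opnorm T); apply: (cstar_norm_repr (A := crossed_alg R[i] H K) (f := fun T => T)) => //=.
exact: (sa_star_sub P).
Qed.

Lemma dg_weak_hopf : weak_hopf_cstar (dg_wh R[i] H K).
Proof.
apply: (weak_hopf_of_boxes mHK (dg_box_basis _ mHK)).
- exact: dg_starAlgP.
- exact: dg_delta_lin.
- exact: dg_S_lin.
- exact: dg_eps_lin.
- exact: dg_cstar.
Qed.

Lemma crossed_weak_hopf : weak_hopf_cstar (crossed_wh R[i] H K).
Proof.
apply: (weak_hopf_of_boxes mHK (crossed_box_basis _ mHK)).
- exact: crossed_starAlgP.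
- by move=> k S T; rewrite /= Gamma_lin linearP.
- exact: kappa_lin.
- exact: eps_lin.
- exact: crossed_cstar.
Qed.

End CstarStructure.

Theorem theorem4p2p5 (R : realType) (G : finGroupoid) (H K : {set G})
    (mHK : match_pair H K) :
  (* 1) *)
  ((forall b b' : box H K,
      conv (chi R[i] H K (val b)) (chi R[i] H K (val b'))
      = if vcomposable b b' then chi R[i] H K (vcomp b b') else 0)
   /\ (forall b : box H K,
      sharp (chi R[i] H K (val b))
      = chi R[i] H K (bottom b, ginv (right b)))
   /\ cstar_iso (A := dg_alg R[i] H K) (B := crossed_box_alg R[i] H K)
        (@Rdelta R[i] G H K))
  /\
  (* 2) *)
  ((forall b : box H K,
      Gamma H K (RdeltaG (chi R[i] H K (val b)))
      = \sum_(bb : box H K * box H K |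
            hcomposable bb.1 bb.2 && (hcomp bb.1 bb.2 == val b))
          optens (RdeltaG (chi R[i] H K (val bb.1)))
                 (RdeltaG (chi R[i] H K (val bb.2))))
   /\ (forall b : box H K,
      kappa H K (RdeltaG (chi R[i] H K (val b)))
      = RdeltaG (chi R[i] H K (ginv (bottom b), ginv (left b))))
   /\ (forall b : box H K,
      eps H K (RdeltaG (chi R[i] H K (val b)))
      = (top b == grng (right b))%:R)
   /\ weak_hopf_cstar_iso (A := dg_wh R[i] H K) (B := crossed_wh R[i] H K)
        (@RdeltaG R[i] G H K)).
Proof.
split.
  split; first exact: conv_chi.
  split; first exact: sharp_chi.
  split; [exact: dg_cstar|exact: crossed_box_cstar|exact: Rdelta_star_iso].
split=> [b|].
  rewrite Gamma_chi //.
  by rewrite -(sum_hfactor mHK b (fun c d => optens (RdeltaG (chi R[i] H K (val c)))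
    (RdeltaG (chi R[i] H K (val d))))).
split=> [b|]; first by rewrite kappa_chi // val_hvinv.
split=> [b|]; first by rewrite eps_chi // -src_top eq_sym.
split; [exact: dg_weak_hopf|exact: crossed_weak_hopf|exact: RdeltaG_star_iso|].
by move=> F _; apply: RdeltaG_structure.
Qed.
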